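(* Let $G$ be a linear semisimple Lie group, $\Gamma\le G$ a lattice, $X=G/\Gamma$, and $m$ the probability measure on $X$ induced by a Haar measure on $G$. Let $H=\{u_v: v\in\mathbb{R}^d\}\le G$ be an abelian subgroup, identified with $\mathbb{R}^d$. Let $x\in X$ be an $H$-generic point, namely $\overline{H.x}=X$, which has an effective equidistribution theorem of rate $\gamma_{\mathrm E}>0$ with respect to $H$ and functions of bounded Sobolev norm of order $K$. Then there exists an exponent $\omega_{\mathrm{critical}}<1$ such that for every exponent $\omega$ with $\omega_{\mathrm{critical}}<\omega\le 1$, the average over the annulus of inner radius $R/2$ and outer radius $R/2+R^{\omega}$, $$A_{R,\omega}(f)(x)=\frac1{R^{\omega}}\int_{0}^{R^{\omega}}\sigma_{R/2+t}(f)(x)\,dt,$$ equidistributes with a rate $\delta=\delta(\gamma_{\mathrm E},\omega)>0$, namely, for every smooth function $f$ on $X$ with finite Sobolev norm of order $K$, $$\left|A_{R,\omega}(f)(x)-\int_X f\,dm\right|\ll_f R^{-\delta}.$$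
   Context: $G$ acts on $X$ by left translations, written $g.x$. For $r>0$, $\sigma_r(f)(x)=\int_{\|\hat v\|=1} f(u_{r\hat v}.x)\,d\sigma(\hat v)$, where $\sigma$ is the rotation-invariant probability measure on the Euclidean unit sphere of $\mathbb{R}^d$. $B_R^H=\{u_v:\|v\|\le R\}$, with $\mathrm{vol}_H$ and $dh$ the Haar (Lebesgue) measure of $H\simeq\mathbb{R}^d$. Effective equidistribution: a point $x_0\in G/\Gamma$ has an effective equidistribution theorem of rate $\gamma>0$ with respect to $H$ and some Sobolev norm of order $K$ (a norm involving derivatives up to order $K$) if there exists $R_0=R_0(x_0)>0$ such that for any function $f:X\to\mathbb{C}$ of compact support and vanishing integral (and finite Sobolev norm of order $K$) and any $R>R_0$, $$\left|\frac1{\mathrm{vol}_H(B_R^H)}\int_{B_R^H}f(h.x_0)\,dh\right|\ll_f R^{-\gamma}.$$ The notation $\ll_f$ means inequality up to a multiplicative constant that may depend on $f$ (and on the fixed data) but not on $R$.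
   Formalization: The effective equidistribution hypothesis is assumed for all C^K functions of vanishing integral and finite Sobolev norm of order K, not only compactly supported ones; for noncompact X the compactly supported version fails for dense orbits that spend most of their time in the cusp. *)

(* Defs.v *)
From HB Require Import structures.
From mathcomp Require Import all_boot all_order all_algebra.
From mathcomp Require Import complex.
From mathcomp Require Import all_classical all_reals all_analysis.

Set Implicit Arguments.
Unset Strict Implicit.
Unset Printing Implicit Defensive.

Import Order.TTheory GRing.Theory Num.Theory.
Import numFieldNormedType.Exports.

Local Open Scope classical_set_scope.
Local Open Scope ring_scope.

Notation borel T := (g_sigma_algebraType (@open T)).

(* A linear Lie group is a subgroup of GL_n(R) that is closed in GL_n(R); it
   need not be closed in the space of all matrices. *)
Record linearLieGroup (R : realType) (n : nat) := LinearLieGroup {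
  lg_set :> set 'M[R]_n ;
  lg_unit : forall g, lg_set g -> g \in unitmx ;
  lg_one : lg_set 1%:M ;
  lg_mul : forall g h, lg_set g -> lg_set h -> lg_set (g *m h) ;
  lg_inv : forall g, lg_set g -> lg_set (invmx g) ;
  lg_closed : forall g, closure lg_set g -> g \in unitmx -> lg_set g }.

Section LieAlgebra.
Context {R : realType} {n : nat}.
Implicit Types (A B : 'M[R]_n) (U I L : {vspace 'M[R]_n}).

Definition expmx A : 'M[R]_n :=
  limn (series (fun k => (k`!%:R)^-1 *: A ^+ k)).

Definition is_lie_algebra (G : set 'M[R]_n) L : Prop :=
  forall A, A \in L <-> (forall t : R, G (expmx (t *: A))).

Definition lie_bracket A B : 'M[R]_n := A *m B - B *m A.

Definition is_lie_ideal L I : Prop :=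
  (I <= L)%VS /\ forall A B, A \in L -> B \in I -> lie_bracket A B \in I.

Definition derived_lie U : {vspace 'M[R]_n} :=
  <<[seq lie_bracket A B | A <- vbasis U, B <- vbasis U]>>%VS.

Definition solvable_lie U : Prop := exists k, iter k derived_lie U = 0%VS.

(* The radical, i.e. the largest solvable ideal, is zero. *)
Definition semisimple_lie L : Prop :=
  forall I, is_lie_ideal L I -> solvable_lie I -> I = 0%VS.

End LieAlgebra.

Section HomogeneousSpace.
Context {R : realType} {n : nat}.

Definition lcoset (Gamma : set 'M[R]_n) (g : 'M[R]_n) : set 'M[R]_n :=
  [set g *m c | c in Gamma].

Record homog (G : linearLieGroup R n) (Gamma : set 'M[R]_n) := Homog {
  coset :> set 'M[R]_n ;
  cosetP : coset \in [set lcoset Gamma g | g in lg_set G] }.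

Section Structures.
Variables (G : linearLieGroup R n) (Gamma : set 'M[R]_n).
Local Notation X := (homog G Gamma).

HB.instance Definition _ := [isSub for @coset G Gamma].
HB.instance Definition _ := [Choice of X by <:].

Definition homog_base : X :=
  Homog (mem_set (imageP (lcoset Gamma) (lg_one G))).

HB.instance Definition _ := isPointed.Build X homog_base.

(* Quotient topology: U is open iff its preimage in G is the trace on G of an
   open set of matrices. *)
Definition homog_open : set_system X := [set U | exists2 V : set 'M[R]_n,
  open V & forall (y : X) g,
    lg_set G g -> coset y = lcoset Gamma g -> V g <-> U y].

Let homog_openT : homog_open setT.
Proof. by exists setT => //; exact: openT. Qed.

Let homog_openI : setI_closed homog_open.
Proof.
move=> U1 U2 [V1 oV1 h1] [V2 oV2 h2]; exists (V1 `&` V2); first exact: openI.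
move=> y g Gg yg; split=> -[].
  by move=> /(h1 _ _ Gg yg) ? /(h2 _ _ Gg yg).
by move=> /(h1 _ _ Gg yg) ? /(h2 _ _ Gg yg).
Qed.

Let homog_open_bigU (J : Type) (f : J -> set X) :
  (forall i, homog_open (f i)) -> homog_open (\bigcup_i f i).
Proof.
move=> hf; have /choice[V hV] : forall i, exists V : set 'M[R]_n, open V /\
    forall (y : X) g, lg_set G g -> coset y = lcoset Gamma g -> V g <-> f i y.
  by move=> i; have [V ? ?] := hf i; exists V.
exists (\bigcup_i V i); first by apply: bigcup_open => i _; case: (hV i).
by move=> y g Gg yg; split=> -[i _ /((hV i).2 _ _ Gg yg) ?]; exists i.
Qed.

HB.instance Definition _ :=
  isOpenTopological.Build X homog_openT homog_openI homog_open_bigU.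

(* Left translation by h, meaningful for h in G (for h outside G the translate
   may fail to be a coset in G, and then y is returned). *)
Definition act (h : 'M[R]_n) (y : X) : X :=
  insubd y [set h *m z | z in coset y].

Lemma coset_act (h : 'M[R]_n) (y : X) : lg_set G h ->
  coset (act h y) = [set h *m z | z in coset y].
Proof.
move=> Gh; rewrite insubdK //; apply: mem_set.
have [g Gg <-] := set_mem (valP y); exists (h *m g); first exact: lg_mul.
apply/seteqP; split=> z.
  by move=> [c Gc <-]; exists (g *m c); [exists c|rewrite mulmxA].
by move=> [_ [c Gc <-] <-]; exists c => //; rewrite mulmxA.
Qed.

End Structures.
End HomogeneousSpace.

Section Haar.
Context {R : realType} {n : nat}.
Implicit Types (G : linearLieGroup R n) (Gamma F : set 'M[R]_n).

(* A Haar measure of G, seen as a Borel measure on matrices carried by G. *)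
Definition is_haar G (mu : {measure set (borel 'M[R]_n) -> \bar R}) : Prop :=
  [/\ mu (~` G) = 0%E, (0 < mu G)%E,
      forall K : set 'M[R]_n, compact K -> K `<=` G -> (mu K < +oo)%E
    & forall g (B : set (borel 'M[R]_n)), lg_set G g -> measurable B ->
        mu [set g *m b | b in B] = mu B].

Definition is_discrete_subgroup G Gamma : Prop :=
  [/\ Gamma `<=` G, Gamma 1%:M,
      forall a b, Gamma a -> Gamma b -> Gamma (a *m b),
      forall a, Gamma a -> Gamma (invmx a)
    & exists2 V : set 'M[R]_n, open V & V `&` Gamma = [set 1%:M]].

Definition is_fundamental_domain G Gamma F : Prop :=
  [/\ measurable (F : set (borel 'M[R]_n)), F `<=` G
    & forall g, lg_set G g -> exists! c, Gamma c /\ F (g *m c)].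

Definition is_lattice G Gamma : Prop :=
  is_discrete_subgroup G Gamma /\
  exists mu F, [/\ is_haar G mu, is_fundamental_domain G Gamma F
                 & (mu F < +oo)%E].

(* m is the image of mu restricted to a fundamental domain and normalized. *)
Definition induced_by_haar G Gamma
    (m : probability (borel (homog G Gamma)) R) : Prop :=
  exists mu F, [/\ is_haar G mu, is_fundamental_domain G Gamma F,
    (mu F < +oo)%E
    & forall B : set (borel (homog G Gamma)), measurable B ->
        mu (F `&` \bigcup_(y in B) coset y) = (mu F * m B)%E].

End Haar.

Section ComplexValued.
Context {R : realType}.
Local Open Scope complex_scope.

Definition cabs (z : R[i]) : R := ComplexField.Normc.normc z.

Definition cintegral d (T : measurableType d) (mu : {measure set T -> \bar R})
    (D : set T) (f : T -> R[i]) : R[i] :=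
  (\int[mu]_(y in D) complex.Re (f y)) +i* (\int[mu]_(y in D) complex.Im (f y)).

End ComplexValued.

Section Sobolev.
Context {R : realType} {n : nat} (G : linearLieGroup R n).
Context (Gamma : set 'M[R]_n) (L : {vspace 'M[R]_n}).
Local Notation X := (homog G Gamma).
Local Open Scope complex_scope.
Implicit Types (A : 'M[R]_n) (f : X -> R[i]).

Definition flow_re A f (y : X) (t : R) : R :=
  complex.Re (f (act (expmx (t *: A)) y)).
Definition flow_im A f (y : X) (t : R) : R :=
  complex.Im (f (act (expmx (t *: A)) y)).

(* The derivative at time 0 of f along t |-> exp(tA).y. *)
Definition lie_derive A f : X -> R[i] :=
  fun y => derive1 (flow_re A f y) 0 +i* derive1 (flow_im A f y) 0.

(* The vector fields y |-> d/dt exp(tA).y, A in the Lie algebra L of G, span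
   every tangent space of X, so f is of class C^k iff its iterated derivatives
   along them up to order k exist and are continuous. *)
Fixpoint class_C (k : nat) f : Prop :=
  [/\ continuous (fun y => complex.Re (f y)),
      continuous (fun y => complex.Im (f y))
    & if k is k'.+1 then forall A, A \in L ->
        (forall y, derivable (flow_re A f y) 0 1 /\
                   derivable (flow_im A f y) 0 1) /\
        class_C k' (lie_derive A f)
      else True].

Definition smooth f : Prop := forall k, class_C k f.

Definition lie_monomial (s : seq 'I_(\dim L)) f : X -> R[i] :=
  foldr (fun i => lie_derive (tnth (vbasis L) i)) f s.

Definition sobolev_norm (m : probability (borel X) R) (p : \bar R) (K : nat) f
    : \bar R :=
  (\sum_(k < K.+1) \sum_(s : k.-tuple 'I_(\dim L))
     'N[m]_p[(fun y => (cabs (lie_monomial s f y))%:E)])%E.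

(* The norm only makes sense when the derivatives up to order K exist. *)
Definition sobolev_class (m : probability (borel X) R) (p : \bar R) (K : nat)
    : set (X -> R[i]) :=
  [set f | class_C K f /\ (sobolev_norm m p K f < +oo)%E].

End Sobolev.

Section Averages.
Context {R : realType} {n d : nat} (G : linearLieGroup R n).
Context (Gamma : set 'M[R]_n) (u : 'rV[R]_d -> 'M[R]_n).
Local Notation X := (homog G Gamma).
Local Open Scope complex_scope.

(* v |-> u_v identifies R^d with an abelian Lie subgroup of G. *)
Definition is_Rd_subgroup : Prop :=
  [/\ forall v, lg_set G (u v), forall v w, u (v + w) = u v *m u w,
      injective u & continuous u].

(* The library norm on row vectors is the sup norm. *)
Definition enorm (v : 'rV[R]_d) : R := Num.sqrt (\sum_j v 0 j ^+ 2).

Definition eball (r : R) : set 'rV[R]_d := [set v | enorm v <= r].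

Definition esphere : set 'rV[R]_d := [set v | enorm v = 1].

Definition is_haar_Rd (lam : {measure set (borel 'rV[R]_d) -> \bar R}) : Prop :=
  [/\ (0 < lam setT)%E,
      forall K : set 'rV[R]_d, compact K -> (lam K < +oo)%E
    & forall v (B : set (borel 'rV[R]_d)), measurable B ->
        lam [set v + b | b in B] = lam B].

(* Invariance is under the full orthogonal group: for d >= 2 this is the same
   as invariance under SO(d), while for d = 1 it is what makes the measure on
   {-1, 1} uniform. *)
Definition is_sphere_measure (sigma : probability (borel 'rV[R]_d) R) : Prop :=
  sigma esphere = 1%E /\
  forall (O : 'M[R]_d) (B : set (borel 'rV[R]_d)),
    O *m O^T = 1%:M -> measurable B -> sigma [set b *m O | b in B] = sigma B.

Definition orbit (x : X) : set X := [set act (u v) x | v in setT].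

Definition generic (x : X) : Prop := closure (orbit x) = setT.

Definition ball_average (lam : {measure set (borel 'rV[R]_d) -> \bar R})
    (r : R) (f : X -> R[i]) (x : X) : R[i] :=
  ((fine (lam (eball r)))^-1)%:C *
  cintegral lam (eball r) (fun v => f (act (u v) x)).

Definition sphere_average (sigma : probability (borel 'rV[R]_d) R)
    (r : R) (f : X -> R[i]) (x : X) : R[i] :=
  cintegral sigma esphere (fun v => f (act (u (r *: v)) x)).

Definition annulus_average (sigma : probability (borel 'rV[R]_d) R)
    (omega r : R) (f : X -> R[i]) (x : X) : R[i] :=
  ((r `^ omega)^-1)%:C *
  cintegral lebesgue_measure `[0, r `^ omega]
    (fun t : R => sphere_average sigma (r / 2 + t) f x).

(* D is the class of test functions. The functions of finite Sobolev norm that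
   have compact support are not a large enough class to deduce anything about
   all functions of finite Sobolev norm when X is not compact: if the orbit of x
   escapes to the cusp for most of the time, then the averages of every
   compactly supported f tend to 0 (possibly at a polynomial rate), whatever the
   integral of f, even though the orbit may be dense. *)
Definition effective_equidistribution
    (lam : {measure set (borel 'rV[R]_d) -> \bar R})
    (m : probability (borel X) R) (D : set (X -> R[i])) (gamma : R) (x : X)
    : Prop :=
  exists2 R0 : R, 0 < R0 & forall f, D f -> cintegral m setT f = 0 ->
    exists C : R, forall r, R0 < r ->
      cabs (ball_average lam r f x) <= C * r `^ (- gamma).

End Averages.

(* Main.v *)
(* Write B r for the mean of h v = f(u_v.x) - int f dm over the ball of radius r
   and H r for its mean over the sphere of radius r. The Haar measure of R^d is
   rotation invariant and the volume V of balls is homogeneous, V r = V 1 * r^a,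
   so V B has the derivative V' H. Hence H = (r B / a)' + (1 - 1 / a) B, and a
   bound B = O(r^-gamma) makes the integral of H over an interval contained in
   [r / 2, 3 r / 2] an O(r^(1 - gamma)), whatever the length of the interval.
   Dividing by its length r^omega gives the rate delta = gamma + omega - 1,
   which is positive for omega > 1 - gamma. *)
Require Import Defs.
From HB Require Import structures.
From mathcomp Require Import all_boot all_order all_algebra.
From mathcomp Require Import complex.
From mathcomp Require Import all_classical all_reals all_analysis.
From mathcomp Require Import measurable_realfun ess_sup_inf.
From mathcomp Require Import ring lra.

Set Implicit Arguments.
Unset Strict Implicit.
Unset Printing Implicit Defensive.

Import Order.TTheory GRing.Theory Num.Theory.
Import numFieldNormedType.Exports.

Local Open Scope classical_set_scope.
Local Open Scope ring_scope.

(** * Borel sets of products *)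

(** The annulus average gives all radii the same weight, whereas volume weights the radius s by
    s^(a-1), so the difference of two ball integrals is not an annulus average. Dividing by V before
    differentiating removes the weight, at the price of the term (1 - 1/a) B. The Haar measure and
    the sphere measure are given separately, each by its invariance alone, so the derivative V' H of
    V B has to be earned. Two Tonelli arguments do it. Uniqueness of translation-invariant measures
    shows how [lam] behaves under dilations and orthogonal maps. Uniqueness of the
    rotation-invariant measure on the sphere then identifies the radial projection of [lam] on a
    shell with a multiple of [sigma]. Equidistribution is assumed for test functions of integral
    zero only, so it is applied to f minus its integral. This stays in the Sobolev class because [m]
    is a probability measure and p is at least 1. *)

Lemma open_borel_measurable (T : ptopologicalType) (U : set T) : open U ->
  measurable (U : set (borel T)).
Proof. by move=> oU; apply: sub_sigma_algebra. Qed.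

Lemma closed_borel_measurable (T : ptopologicalType) (U : set T) : closed U ->
  measurable (U : set (borel T)).
Proof.
by move=> cU; rewrite -(setCK U); apply: measurableC;
  apply: open_borel_measurable; exact: closed_openC.
Qed.

Lemma continuous_borel_measurable (T T' : ptopologicalType) (f : T -> T') :
  continuous f -> measurable_fun setT (f : borel T -> borel T').
Proof.
move=> cf; apply: (@measurability _ _ (borel T) (borel T') setT f (@open
  T')) => //.
move=> _ [U oU <-]; rewrite setTI; apply: open_borel_measurable.
by apply: open_comp => // x _; exact: cf.
Qed.

Lemma continuous_borel_measurableR (R : realType) (T : ptopologicalType)
  (f : T -> R) :
  continuous f -> measurable_fun setT (f : borel T -> R).
Proof.
move=> cf; apply: (@measurability _ _ (borel T) R setT f
  (@measurable_realfun.RGenOInfty.G R)).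
  exact: measurable_realfun.RGenOInfty.measurableE.
move=> _ [_ [x ->] <-]; rewrite setTI; apply: open_borel_measurable.
by apply: open_comp => // y _; exact: cf.
Qed.

Lemma rat_approx_rV (R : realType) d (x : 'rV[R]_d) (e : R) : 0 < e ->
  exists q : 'rV[rat]_d, ball x e (map_mx ratr q).
Proof.
move=> e0; have h j : exists q : rat, ball (x 0 j) e (ratr q : R).
  have [] := @dense_rat R (ball (x 0 j) e); first by exists (x 0 j);
    exact: ballxx.
    exact: ball_open.
  by move=> y [] /[swap] -[q _ <-]; exists q.
have [q hq] := choice h; exists (\row_j q j).
by split=> // i j; rewrite !mxE ord1.
Qed.

(** Tonelli works with the product of the two Borel sigma-algebras. Second countability puts the
    open sets in it: U is the union of the countably many boxes with rational centre and radius
    1/(k+1) that it contains. *)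
Lemma open_prod_measurable (R : realType) d1 d2 (U : set ('rV[R]_d1 *
  'rV[R]_d2)) :
  open U -> measurable (U : set (borel 'rV[R]_d1 * borel 'rV[R]_d2)).
Proof.
move=> oU.
pose W (i : 'rV[rat]_d1 * 'rV[rat]_d2 * nat) : set ('rV[R]_d1 * 'rV[R]_d2) :=
  ball (map_mx ratr i.1.1 : 'rV[R]_d1) i.2.+1%:R^-1 `*`
  ball (map_mx ratr i.1.2 : 'rV[R]_d2) i.2.+1%:R^-1.
have -> : U = \bigcup_(i in [set i | W i `<=` U]) W i.
  apply/seteqP; split=> [[x y] Uxy|z [i /= WU] Wz]; last exact: WU.
  have [e /= e0 eU] : exists2 e : R, 0 < e & ball (x, y) e `<=` U.
    by have /nbhs_ballP[e e0 eU] := open_nbhs_nbhs (conj oU Uxy); exists e.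
  (* Half of e, because a point of the box is reached from (x, y) in two moves of length 1/(k+1),
     through the rational centre. *)
  have [k _ ke] := near_infty_natSinv_lt (PosNum (divr_gt0 e0 (ltr0n _ 2))).
  have k0 : (0 : R) < k.+1%:R^-1 by rewrite invr_gt0.
  have [q1 h1] := rat_approx_rV x k0.
  have [q2 h2] := rat_approx_rV y k0.
  have ke2 : k.+1%:R^-1 + k.+1%:R^-1 <= e.
    by rewrite (splitr e) lerD// ltW// ke//=.
  exists (q1, q2, k); last by split; exact: ball_sym.
  move=> [a b] [/= ha hb]; apply: eU; split => /=; apply: le_ball ke2 _ _.
    exact: ball_triangle h1 ha.
  exact: ball_triangle h2 hb.
rewrite bigcup_mkcond; apply: countable_bigcupT_measurable => // -[[q1 q2] k].
case: ifP => // _; apply: measurableX; apply: open_borel_measurable;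
  exact: ball_open.
Qed.

Lemma continuous_prod_measurable (R : realType) d1 d2 (T : ptopologicalType)
  (f : 'rV[R]_d1 * 'rV[R]_d2 -> T) :
  continuous f -> measurable_fun setT (f : borel 'rV[R]_d1 * borel 'rV[R]_d2 ->
    borel T).
Proof.
move=> cf; apply: (@measurability _ _ (borel 'rV[R]_d1 * borel 'rV[R]_d2)%type
  (borel T) setT f (@open T)) => //.
move=> _ [U oU <-]; rewrite setTI; apply: open_prod_measurable.
by apply: open_comp => // x _; exact: cf.
Qed.

Lemma continuous_sumr (T : topologicalType) (R : realType) (I : finType)
  (f : I -> T -> R) :
  (forall i, continuous (f i)) -> continuous (fun x => \sum_i f i x).
Proof.
move=> cf; rewrite (_ : (fun x => _) = \sum_i f i); last first.
  by apply/funext => x; rewrite fct_sumE.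
elim/big_ind : _ => // [x|g h cg ch x]; first exact: cst_continuous.
exact: continuousD (cg x) (ch x).
Qed.

Lemma continuous_mx (T : topologicalType) (U : topologicalType) m n (f : T ->
  'M[U]_(m, n)) :
  (forall i j, continuous (fun x => f x i j)) -> continuous f.
Proof.
move=> cf x A [P MP PA]; have : \forall y \near x, forall i j, P i j (f y i j).
  apply: filter_forall => i; apply: filter_forall => j;
    exact: (cf i j x _ (MP i j)).
by apply: filterS => y Py; exact: PA.
Qed.

Lemma continuous_coord (T : topologicalType) (R : realType) m n (f : T ->
  'M[R]_(m, n)) i j :
  continuous f -> continuous (fun x => f x i j).
Proof. move=> cf x; exact: (@continuous_comp _ _ _ f (fun M : 'M[R]_(m, n) => M
  i j) x (cf x) (@coord_continuous _ _ _ i j _)). Qed.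

Lemma continuous_mulmxr (T : topologicalType) (R : realType) m n p (f : T ->
  'M[R]_(m, n)) (A : 'M[R]_(n, p)) :
  continuous f -> continuous (fun x => f x *m A).
Proof.
move=> cf; apply: continuous_mx => i j; under eq_fun do rewrite mxE.
apply: continuous_sumr => k x; apply: cvgMl; exact: continuous_coord.
Qed.

(** * Euclidean norm, balls, spheres and orthogonal matrices *)

Lemma enorm_continuous (R : realType) d : continuous (@enorm R d).
Proof.
move=> v; have := @continuous_comp _ _ _ (fun v : 'rV[R]_d => \sum_j v 0 j ^+
  2) Num.sqrt v.
apply; last exact: sqrt_continuous.
apply: continuous_sumr => k x.
apply: (@continuous_comp _ _ _ (fun v : 'rV[R]_d => v 0 k) (fun x => x ^+ 2)).
  exact: coord_continuous.
exact: exprn_continuous.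
Qed.

Lemma enorm_ge0 (R : realType) d (v : 'rV[R]_d) : 0 <= enorm v.
Proof. exact: sqrtr_ge0. Qed.

Lemma enorm_sqr (R : realType) d (v : 'rV[R]_d) : enorm v ^+ 2 = (v *m v^T) 0 0.
Proof.
rewrite sqr_sqrtr; last by apply: sumr_ge0 => i _; exact: sqr_ge0.
by rewrite mxE; apply: eq_bigr => i _; rewrite mxE expr2.
Qed.

Lemma enormZ (R : realType) d (c : R) (v : 'rV[R]_d) : enorm (c *: v) = `|c| *
  enorm v.
Proof.
apply/eqP; rewrite -(@eqrXn2 _ 2) ?mulr_ge0 ?enorm_ge0// exprMn !enorm_sqr.
by rewrite linearZ/= -scalemxAl -scalemxAr !mxE mulrA real_normK ?num_real//
  expr2.
Qed.

Lemma enorm_orthogonal (R : realType) d (O : 'M[R]_d) (v : 'rV[R]_d) : O *m O^T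
  = 1%:M -> enorm (v *m O) = enorm v.
Proof.
move=> OO; apply/eqP; rewrite -(@eqrXn2 _ 2) ?enorm_ge0// !enorm_sqr.
by rewrite trmx_mul mulmxA -(mulmxA v) OO mulmx1.
Qed.

Lemma mx_norm_le_enorm (R : realType) d (v : 'rV[R]_d) : `|v| <= enorm v.
Proof.
rewrite [leLHS]/Num.norm /= mx_normrE; apply/bigmax_leP; split;
  first exact: enorm_ge0.
move=> [i j] _ /=; rewrite ord1 -[leLHS]ger0_norm// -sqrtr_sqr ler_wsqrtr//.
rewrite real_normK ?num_real// (bigD1 j)//= lerDl sumr_ge0// => k _;
  exact: sqr_ge0.
Qed.

Lemma enorm_eq0 (R : realType) d (v : 'rV[R]_d) : enorm v = 0 -> v = 0.
Proof.
by move=> v0; apply/eqP; rewrite -normr_le0 -v0 mx_norm_le_enorm.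
Qed.

Lemma eball_closed (R : realType) d (r : R) : closed (@eball R d r).
Proof. have := @preimage_closed _ _ (@enorm R d) [set x | x <= r].
by apply; [move=> x _; exact: enorm_continuous|exact: closed_le]. Qed.

Lemma eball_compact (R : realType) d (r : R) : compact (@eball R d r).
Proof.
apply: bounded_closed_compact; last exact: eball_closed.
exists r; split; rewrite ?num_real// => s rs v /= vr.
by rewrite (le_trans (mx_norm_le_enorm v))// (le_trans vr)// ltW.
Qed.

Lemma esphere_closed (R : realType) d : closed (@esphere R d).
Proof.
have := @preimage_closed _ _ (@enorm R d) [set x | x = 1].
by apply; [move=> x _; exact: enorm_continuous|exact: closed_eq].
Qed.

Lemma esphere_compact (R : realType) d : compact (@esphere R d).
Proof.
apply: (subclosed_compact (@esphere_closed R d) (@eball_compact R d 1)).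
by move=> v; rewrite /esphere /eball /= => ->.
Qed.

(* The Householder reflection that swaps v and w. *)
Lemma esphere_transitive (R : realType) d (v w : 'rV[R]_d) : enorm v =
  enorm w ->
  exists2 O : 'M[R]_d, O *m O^T = 1%:M & v *m O = w.
Proof.
move=> vw; have [->|nvw] := eqVneq v w.
  by exists 1%:M; rewrite ?trmx1 ?mulmx1.
pose x := v - w; pose q := (x *m x^T) 0 0.
have q0 : q != 0.
  rewrite /q -enorm_sqr sqrf_eq0; apply: contra nvw => /eqP/enorm_eq0/eqP.
  by rewrite subr_eq0.
have xq : x *m x^T = q%:M by rewrite [LHS]mx11_scalar.
(* Equal norms make the inner product of v with x = v - w half of q = |x|^2, so the reflection sends
   v to v - x = w. *)
have vx : (v *m x^T) = (q / 2)%:M.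
  rewrite [LHS]mx11_scalar; congr _%:M; rewrite /q.
  have : (v *m v^T) 0 0 = (w *m w^T) 0 0 by rewrite -!enorm_sqr vw.
  have : (v *m w^T) 0 0 = (w *m v^T) 0 0 by rewrite -[in LHS](trmxK v) -trmx_mul
    mxE.
  rewrite /x linearB/= !mulmxBr !mulmxBl !mxE => -> ->.
  by field.
exists (1%:M - (2 / q) *: (x^T *m x)).
  set A := x^T *m x; have AA : A *m A = q *: A.
    by rewrite /A mulmxA -(mulmxA x^T x) xq mul_mx_scalar scalemxAl.
  have -> : (1%:M - (2 / q) *: A)^T = 1%:M - (2 / q) *: A.
    by apply/matrixP => i j; rewrite !mxE eq_sym; congr (_ - _ * _);
      apply: eq_bigr => k _; rewrite !mxE mulrC.
  rewrite mulmxBr mulmx1 mulmxBl mul1mx -scalemxAl -scalemxAr AA !scalerA.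
  have -> : 2 / q * (2 / q) * q = 2 / q + 2 / q by field.
  by rewrite scalerDl opprB [X in _ - _ + X]addrK subrK.
rewrite mulmxBr mulmx1 -scalemxAr mulmxA vx mul_scalar_mx scalerA.
have -> : 2 / q * (q / 2) = 1 by field.
by rewrite scale1r /x opprB addrC subrK.
Qed.

(** * Haar measures of R^d *)

Definition translation_invariant (R : realType) d (mu : set (borel 'rV[R]_d) ->
  \bar R) :=
  forall v (A : set (borel 'rV[R]_d)), measurable A -> mu [set w | A (w + v)] =
    mu A.

Lemma tonelli_sections d1 d2 (T1 : measurableType d1) (T2 : measurableType d2)
  (R : realType)
  (mu : {sigma_finite_measure set T1 -> \bar R}) (nu : {sigma_finite_measure set
    T2 -> \bar R}) (P : set (T1 * T2)) :
  measurable P -> (\int[mu]_x nu (xsection P x) = \int[nu]_y mu (ysection P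
    y))%E.
Proof.
move=> mP; have := indic_fubini_tonelli mu nu mP.
by rewrite indic_fubini_tonelli_FE// indic_fubini_tonelli_GE.
Qed.

Lemma integral_cst_on (d : measure_display) (T : measurableType d)
  (R : realType) (mu : {measure set T -> \bar R}) (A : set T) (f : T ->
  \bar R) (c : \bar R) :
  measurable A -> (0 <= c)%E -> (forall x, A x -> f x = c) ->
    (forall x, ~ A x -> f x = 0%E) -> (\int[mu]_x f x = c * mu A)%E.
Proof.
move=> mA c0 fA fN; rewrite -(@integral_cst _ _ _ mu A mA) [RHS]integral_mkcond.
apply: eq_integral => x _; rewrite patchE; case: ifPn => [/set_mem/fA//|].
by move=> /negP xA; apply: fN => Ax; apply: xA; rewrite inE.
Qed.

Section SigmaFiniteCopy.
Context (d : measure_display) (T : measurableType d) (R : realType)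
  (mu : {measure set T -> \bar R}).
Hypothesis h : sigma_finite setT mu.

(** Tonelli takes bundled sigma-finite measures, while here sigma-finiteness is a derived fact. The
    proof is made an argument so that the instance can be attached to the copy. *)
Definition sigma_finite_copy (_ : sigma_finite setT mu) : set T -> \bar R := mu.

Let copy0 : sigma_finite_copy h set0 = 0%E.
Proof. exact: measure0. Qed.

Let copy_ge0 A : (0 <= sigma_finite_copy h A)%E.
Proof. exact: measure_ge0. Qed.

Let copy_additive : semi_sigma_additive (sigma_finite_copy h).
Proof. exact: measure_semi_sigma_additive. Qed.

HB.instance Definition _ := isMeasure.Build _ _ _ (sigma_finite_copy h) copy0
  copy_ge0 copy_additive.
HB.instance Definition _ := Measure_isSigmaFinite.Build _ _ _ (sigma_finite_copy
  h) h.

Lemma exists_sigma_finite_measure :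
  exists mu' : {sigma_finite_measure set T -> \bar R}, (mu' : set T ->
    \bar R) = mu.
Proof. by exists (sigma_finite_copy h). Qed.

End SigmaFiniteCopy.

Lemma measurable_preimage (T T' : ptopologicalType) (f : T ->
  T') (A : set (borel T')) :
  continuous f -> measurable A -> measurable (f @^-1` A : set (borel T)).
Proof. by move=> cf mA; rewrite -[X in measurable X]setTI;
  exact: continuous_borel_measurable. Qed.

(* Tonelli on {(x, y) | x in A, x + y in B}, followed by the substitution
   x := x - y. *)
Lemma translation_invariant_unique (R : realType) (d : nat)
  (mu lam : {sigma_finite_measure set (borel 'rV[R]_d) ->
  \bar R}) (A B : set (borel 'rV[R]_d)) :
  translation_invariant mu -> translation_invariant lam -> measurable A ->
    measurable B ->
  (lam B * mu A = lam ((fun w : 'rV[R]_d => (- w)%R) @^-1` A) * mu B)%E.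
Proof.
move=> hmu hlam mA mB; pose E := borel 'rV[R]_d.
have cN : continuous (fun w : 'rV[R]_d => - w) by move=> w;
  exact: opp_continuous.
pose P : set (E * E) := [set z | A z.1 /\ B ((z.1 : 'rV[R]_d) + z.2)].
pose Q : set (E * E) := [set z | B z.1 /\ A ((z.1 : 'rV[R]_d) - z.2)].
have mP : measurable P.
  apply: measurableI; first by rewrite -[X in measurable X]setTI;
    exact: measurable_fst.
  rewrite -[X in measurable X]setTI; apply: (@continuous_prod_measurable R d d
    'rV[R]_d (fun z => z.1 + z.2)) => //.
  by move=> z; exact: add_continuous.
have mQ : measurable Q.
  apply: measurableI; first by rewrite -[X in measurable X]setTI;
    exact: measurable_fst.
  rewrite -[X in measurable X]setTI; apply: (@continuous_prod_measurable R d d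
    'rV[R]_d (fun z => z.1 - z.2)) => //.
  by move=> z; exact: sub_continuous.
transitivity (\int[mu]_x lam (xsection P x))%E.
  apply/esym/integral_cst_on => // x; rewrite /xsection /P/=.
    move=> Ax; rewrite -(hlam x _ mB); congr (lam _); apply/seteqP;
      split=> y /=; rewrite inE/= addrC.
      by case.
    by [].
  by move=> nA; rewrite [X in lam X](_ : _ = set0) ?measure0//; apply/seteqP;
    split=> y //=; rewrite inE/= => -[].
transitivity (\int[mu]_x lam (xsection Q x))%E; last first.
  apply: integral_cst_on => //; rewrite /xsection /Q/= => x.
    have mA' : measurable ((fun w : 'rV[R]_d => - w) @^-1` A : set (borel
      'rV[R]_d)) by exact: (@measurable_preimage _ _ (fun w : 'rV[R]_d => - w)).
    move=> Bx; rewrite -(hlam (- x) _ mA'); congr (lam _); apply/seteqP;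
      split=> y /=; rewrite inE/= opprB.
      by case.
    by [].
  by move=> nB; rewrite [X in lam X](_ : _ = set0) ?measure0//; apply/seteqP;
    split=> y //=; rewrite inE/= => -[].
(* For fixed y the sections of P and Q are translates of each other by y, and [mu] is invariant. *)
rewrite !tonelli_sections//; apply: eq_integral => y _.
rewrite -(hmu y _ (measurable_ysection y mQ)); congr (mu _);
  rewrite /ysection /P /Q /=.
by apply/seteqP; split=> x /=; rewrite !inE/= addrK => -[].
Qed.

Lemma mule_pI (R : realDomainType) (c : R) (x y : \bar R) : 0 < c ->
  (c%:E * x = c%:E * y)%E -> x = y.
Proof.
move=> c0 h; have c0' : (0 < c%:E)%E by rewrite lte_fin.
have m := @lee_pmul2l _ c%:E isT c0'.
by apply: le_anti; rewrite -(m x y) -(m y x) h lexx.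
Qed.

Lemma haar_translation_invariant (R : realType) d (lam : {measure set (borel
  'rV[R]_d) -> \bar R}) :
  is_haar_Rd lam -> translation_invariant lam.
Proof.
move=> [_ _ h] v A mA; rewrite -(h (- v) A mA); congr (lam _).
apply/seteqP; split=> [w /= Aw|_ [w Aw <-]/=]; last by rewrite addrC addrA subrr
  add0r.
by exists (w + v) => //; rewrite addrC addrK.
Qed.

Lemma eball_measurable (R : realType) d (r : R) : measurable (eball r : set
  (borel 'rV[R]_d)).
Proof. by apply: closed_borel_measurable; exact: eball_closed. Qed.

Lemma bigcup_eball (R : realType) d : \bigcup_k (@eball R d k%:R) = setT.
Proof.
apply/seteqP; split=> // v _; exists (Num.Def.truncn (enorm v)).+1 => //=.
by rewrite /eball/= ltW// truncnS_gt.
Qed.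

Lemma haar_sigma_finite (R : realType) d (lam : {measure set (borel 'rV[R]_d) ->
  \bar R}) :
  is_haar_Rd lam -> sigma_finite setT lam.
Proof.
move=> [_ h _]; exists (fun k => eball k%:R); first by rewrite bigcup_eball.
move=> k; split; first exact: eball_measurable.
by apply: h; exact: eball_compact.
Qed.

Lemma exists_pushforward_measure d1 d2 (T1 : measurableType d1)
  (T2 : measurableType d2) (R : realType) (mu : {measure set T1 ->
  \bar R}) (f : T1 -> T2) : measurable_fun setT f ->
  exists nu : {measure set T2 -> \bar R}, (nu : set T2 ->
    \bar R) = (fun A => mu (f @^-1` A)).
Proof.
move=> mf;
  by exists (measure_function_pushforward__canonical__measure_function_Measure
  mu mf).
Qed.

(** The image of [lam] under v |-> v M is again translation invariant, so uniqueness applies. The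
    identity stays cross-multiplied, since the measures of A and B may be zero or infinite. *)
Lemma haar_linear_image (R : realType) d (lam : {measure set (borel 'rV[R]_d) ->
  \bar R}) (M : 'M[R]_d) (A B : set (borel 'rV[R]_d)) :
  is_haar_Rd lam -> M \in unitmx -> measurable A -> measurable B ->
  (lam B * lam ((fun v : 'rV[R]_d => v *m M) @^-1` A) = lam ((fun v : 'rV[R]_d
    => (- v)%R) @^-1` A) * lam ((fun v : 'rV[R]_d => v *m M) @^-1` B))%E.
Proof.
move=> hl uM mA mB.
have cM (N : 'M[R]_d) : continuous (fun v : 'rV[R]_d => v *m N).
  by apply: continuous_mulmxr => x; exact: cvg_id.
have [mu muE] := exists_pushforward_measure lam (continuous_borel_measurable (cM
  M)).
have [lam' lam'E] := exists_sigma_finite_measure (haar_sigma_finite hl).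
have sm : sigma_finite setT mu.
  exists (fun k => (fun v : 'rV[R]_d => v *m invmx M) @^-1` eball k%:R).
    by rewrite -preimage_bigcup bigcup_eball.
  move=> k; split; first exact: measurable_preimage (cM _) (@eball_measurable _
    _ _).
  rewrite muE [X in lam X](_ : _ = eball k%:R); first by case: hl => _ + _;
    apply; exact: eball_compact.
  by apply/seteqP; split=> v /=; rewrite mulmxK.
have [mu' mu'E] := exists_sigma_finite_measure sm.
have := @translation_invariant_unique R d mu' lam' A B; rewrite mu'E lam'E muE;
  apply => //; last exact: haar_translation_invariant.
(* Translating the image measure by v amounts to translating [lam] by v M^-1. *)
move=> v C mC; rewrite -(haar_translation_invariant hl (v *m invmx M)
  (measurable_preimage (cM M) mC)).
by congr (lam _); apply/seteqP; split=> w /=; rewrite mulmxDl mulmxKV.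
Qed.

(** * Volume of balls and invariance under orthogonal matrices *)

Definition ball_volume (R : realType) d (lam : {measure set (borel 'rV[R]_d) ->
  \bar R}) (r : R) : R := fine (lam (eball r)).

Section HaarBalls.
Variables (R : realType) (d : nat) (lam : {measure set (borel 'rV[R]_d) ->
  \bar R}).
Hypothesis hl : is_haar_Rd lam.
Local Notation V := (ball_volume lam).

Lemma ball_volumeE r : lam (eball r) = (V r)%:E.
Proof.
rewrite fineK// ge0_fin_numE//; case: hl => _ + _; apply; exact: eball_compact.
Qed.

Lemma ball_volume_ge0 r : 0 <= V r.
Proof. by rewrite fine_ge0. Qed.

Lemma ball_volume_le : {homo V : r s / r <= s}.
Proof.
move=> r s rs; rewrite -lee_fin -!ball_volumeE; apply: le_measure; rewrite ?inE;
  try exact: eball_measurable.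
by move=> v /= vr; exact: le_trans rs.
Qed.

Lemma eball_opp (r : R) : (fun v : 'rV[R]_d => - v) @^-1` eball r = eball r.
Proof. by apply/seteqP; split=> v /=; rewrite /eball/= -scaleN1r enormZ normrN1
  mul1r. Qed.

(** This compares [lam] with its image under a homothety on two balls. Balls are symmetric, so the
    reflection in [haar_linear_image] disappears. *)
Lemma ball_volume_scale r s t : 0 < s -> V t * V (s * r) = V r * V (s * t).
Proof.
move=> s0; have us : (s^-1)%:M \in unitmx :> bool.
  move=> n; rewrite unitmxE det_scalar unitrX// unitfE invr_neq0// gt_eqF//.
have E u : (fun v : 'rV[R]_d => v *m (s^-1)%:M) @^-1` eball u = eball (s * u).
  apply/seteqP; split=> v /=; rewrite /eball/= mul_mx_scalar enormZ
    gtr0_norm ?invr_gt0//.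
    by rewrite ler_pdivrMl.
  by rewrite ler_pdivrMl.
have := haar_linear_image hl (us d) (@eball_measurable R d r) (@eball_measurable
  R d t).
by rewrite !E eball_opp !ball_volumeE -!EFinM => -[].
Qed.

(** If one ball were null, scaling by t / r would give V t ^ 2 = 0 for every t > 0. The whole space,
    a countable union of balls, would then be null. *)
Lemma ball_volume_gt0 r : 0 < r -> 0 < V r.
Proof.
move=> r0; rewrite lt_neqAle ball_volume_ge0 andbT eq_sym;
  apply/negP => /eqP Vr0.
have V0 t : 0 < t -> V t = 0.
  move=> t0; have := ball_volume_scale r t (divr_gt0 t0 r0).
  rewrite divfK ?gt_eqF// Vr0 mul0r => /eqP; rewrite mulf_eq0 => /orP[] /eqP//.
have [h _ _] := hl; move: h; rewrite ltNge => /negP; apply.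
rewrite -(@bigcup_eball R d).
have /negligibleP : lam.-negligible (\bigcup_k (@eball R d k%:R)).
  apply: negligible_bigcup => k.
  suff h : lam (eball k%:R) = 0%E by apply/negligibleP => //;
    exact: eball_measurable.
  rewrite ball_volumeE; congr EFin; apply/eqP;
    rewrite eq_le ball_volume_ge0 andbT.
  by rewrite -(@V0 k.+1%:R)//; apply: ball_volume_le; rewrite ler_nat.
by move=> ->//; rewrite bigcup_eball; exact: measurableT.
Qed.

Lemma haar_rotation (O : 'M[R]_d) (A : set (borel 'rV[R]_d)) : O *m O^T =
  1%:M -> measurable A ->
  lam ((fun v : 'rV[R]_d => v *m O) @^-1` A) = lam A.
Proof.
move=> + mA.
(* The unit ball is preserved by Q and has finite positive volume, which fixes the proportionality
   factor. The reflected set that remains is removed below by taking Q to be the identity. *)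
have key (Q : 'M[R]_d) : Q *m Q^T = 1%:M -> lam ((fun v : 'rV[R]_d => v *m Q)
  @^-1` A) = lam ((fun v : 'rV[R]_d => (- v)%R) @^-1` A).
  move=> QQ; have uQ : Q \in unitmx by have [] := mulmx1_unit QQ.
  have := haar_linear_image hl uQ mA (@eball_measurable R d 1).
  have -> : (fun v : 'rV[R]_d => v *m Q) @^-1` eball 1 = eball 1.
    by apply/seteqP; split=> v /=; rewrite /eball/= enorm_orthogonal.
  rewrite !ball_volumeE => h.
  by apply: (mule_pI (ball_volume_gt0 ltr01)); rewrite h muleC.
move=> OO; rewrite key// -(key 1%:M) ?trmx1 ?mulmx1//.
by congr (lam _); apply/seteqP; split=> v /=; rewrite mulmx1.
Qed.

End HaarBalls.

(** Cauchy's functional equation. Additivity gives linearity on integers, and monotonicity squeezes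
    the remaining values. *)
Lemma monotone_additive_linear (R : realType) (g : R -> R) :
  {morph g : x y / x + y} -> {homo g : x y / x <= y} -> forall x, g x = g 1 * x.
Proof.
move=> gD gle.
have g0 : g 0 = 0 by apply: (@addrI _ (g 0)); rewrite -gD !addr0.
have gN x : g (- x) = - g x by apply/eqP; rewrite -addr_eq0 -gD addNr g0.
have gMn n x : g (x *+ n) = g x *+ n.
  by elim: n => [|n IH]; rewrite ?mulr0n// !mulrS gD IH.
have gMz (z : int) x : g (x *~ z) = g x *~ z.
  by case: z => n; rewrite ?NegzE ?mulrNz -?pmulrn ?gN gMn.
have g1 : 0 <= g 1 by rewrite -g0; apply: gle.
move=> x; apply/eqP; rewrite -subr_eq0 -normr_le0; apply/ler_addgt0Pr => e e0.
(* With k <= x (n+1) <= k + 1, both g x and g 1 * x, multiplied by n+1, lie between k g 1 and (k+1)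
   g 1. Their distance is thus at most g 1 / (n+1), which this n makes at most e. *)
have [n _ hn] := near_infty_natSinv_lt (PosNum (divr_gt0 e0 (ltr_pwDl (@ltr01 R)
  g1))).
pose k := Num.floor (x * n.+1%:R).
have n0 : (0 : R) < n.+1%:R by [].
have lo : g 1 *~ k <= g x *+ n.+1.
  rewrite -gMz -gMn; apply: gle; rewrite -mulr_natr.
  exact: floor_le.
have hi : g x *+ n.+1 <= g 1 *~ (k + 1).
  rewrite -gMz -gMn; apply: gle; rewrite -mulr_natr.
  exact/ltW/floorD1_gt.
have k1 : k%:~R <= x * n.+1%:R by exact: floor_le.
have k2 : x * n.+1%:R <= (k + 1)%:~R by exact/ltW/floorD1_gt.
rewrite -[g x *+ _]mulr_natr -[g 1 *~ k]mulrzr in lo.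
rewrite -[g x *+ _]mulr_natr -[g 1 *~ (k + 1)]mulrzr in hi.
have := hn n (leqnn n) => /= hn'.
have ng : n.+1%:R^-1 * (1 + g 1) <= e by rewrite -ler_pdivlMr ?ltr_pwDl// ltW.
have : `|g x - g 1 * x| * n.+1%:R <= g 1.
  rewrite -[X in _ * X]ger0_norm// -normrM mulrBl ler_norml.
  have := ler_wpM2l g1 k1; have := ler_wpM2l g1 k2.
  have hK : (k + 1)%:~R = k%:~R + 1 :> R by rewrite intrD.
  rewrite hK in hi *; rewrite -mulrA => a1 a2.
  by apply/andP; split; lra.
rewrite add0r -ler_pdivlMr// => /le_trans; apply; apply: le_trans ng.
by rewrite mulrC ler_wpM2l// ?invr_ge0// lerDr.
Qed.

Lemma enorm_le_mx_norm (R : realType) d (v : 'rV[R]_d) : enorm v <= d%:R * `|v|.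
Proof.
rewrite -[leRHS]ger0_norm ?mulr_ge0// -sqrtr_sqr ler_wsqrtr//.
have h j : v 0 j ^+ 2 <= `|v| ^+ 2.
  rewrite -[v 0 j ^+ 2]real_normK ?num_real// lerXn2r ?nnegrE//.
  rewrite [leRHS]/Num.norm /= mx_normrE; apply/bigmax_geP; right => /=.
  by exists (0, j).
apply: (@le_trans _ _ (\sum_(j < d) `|v| ^+ 2)); first exact: ler_sum.
rewrite sumr_const card_ord exprMn -[_ *+ d]mulr_natl; apply: ler_wpM2r;
  first exact: sqr_ge0.
by rewrite -natrX ler_nat; case: (d) => // k; rewrite leq_pmulr.
Qed.

Section BallVolumePower.
Variables (R : realType) (d : nat) (lam : {measure set (borel 'rV[R]_d) ->
  \bar R}).
Hypothesis hl : is_haar_Rd lam.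
Local Notation V := (ball_volume lam).

(* A monotone multiplicative function is a power. In fact a = d, but only
   a > 0 is ever used; it holds because a large ball contains two disjoint
   translates of a small one. *)
Lemma ball_volume_power : (exists v, @esphere R d v) ->
  exists2 a : R, 0 < a & forall s, 0 < s -> V s = V 1 * s `^ a.
Proof.
move=> [e e1].
have V1 := ball_volume_gt0 hl ltr01.
have WM s r : 0 < s -> V (s * r) / V 1 = V s / V 1 * (V r / V 1).
  move=> s0; have := ball_volume_scale hl r 1 s0; rewrite mulr1 => h.
  have V1n : V 1 != 0 by rewrite gt_eqF.
  have -> : V (s * r) = V r * V s / V 1 by rewrite -h; field.
  by field.
(* V / V 1 is multiplicative by scaling, so in logarithmic coordinates it is additive and
   monotone. *)
pose g x := ln (V (expR x) / V 1).
have W0 x : 0 < x -> 0 < V x / V 1 by move=> x0;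
  rewrite divr_gt0// ball_volume_gt0.
have gE : forall x, g x = g 1 * x.
  apply: monotone_additive_linear => [x y|x y xy].
    by rewrite /g expRD WM ?expR_gt0// lnM// posrE W0 ?expR_gt0.
  rewrite /g ler_ln ?posrE ?W0 ?expR_gt0// ler_pM2r ?invr_gt0//.
  by apply: ball_volume_le => //; rewrite ler_expR.
have VE s : 0 < s -> V s = V 1 * s `^ (g 1).
  move=> s0; rewrite /powR gt_eqF// -gE /g lnK ?posrE// lnK ?posrE ?W0//.
  by rewrite mulrC divfK// gt_eqF.
have g_mono : {homo g : x y / x <= y}.
  move=> x y xy; rewrite /g ler_ln ?posrE ?W0 ?expR_gt0// ler_pM2r ?invr_gt0//.
  by apply: ball_volume_le => //; rewrite ler_expR.
exists (g 1) => //; rewrite lt_neqAle; apply/andP; split; last first.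
  by rewrite -[leLHS](mulr0 (g 1)) -gE; apply: g_mono.
(* With exponent 0 all balls of positive radius would have volume V 1. The unit vector e, which
   exists only for d > 0, provides the two disjoint small balls. *)
apply/eqP => g10.
pose ne := `|e|; have ne0 : 0 < ne.
  rewrite normr_gt0; apply/eqP => ez; move: e1; rewrite /esphere/= ez -(scale0r
    0) enormZ normr0 mul0r.
  by move/eqP; rewrite eq_sym oner_eq0.
(* [ne] is the sup norm of e, and Euclidean balls lie in sup balls of the same radius, so the balls
   of radius ne / 4 about 0 and e are disjoint. M bounds the Euclidean norm on both, by d times the
   sup norm on the second. *)
pose r := ne / 4; have r0 : 0 < r by rewrite divr_gt0.
pose M := r + d%:R * (ne + r).
have rM : r <= M by rewrite lerDl mulr_ge0// addr_ge0// ltW.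
have M0 : 0 < M by exact: lt_le_trans rM.
pose B : set (borel 'rV[R]_d) := [set w | eball r (w - e)].
have mB : measurable B.
  apply: (@measurable_preimage _ _ (fun w : 'rV[R]_d => w - e) (eball r));
    last exact: eball_measurable.
  move=> w; apply: (@continuousB _ _ _ (fun w => w) (fun=> e));
    last exact: cst_continuous.
  exact: cvg_id.
have lB : lam B = (V r)%:E.
  by rewrite -ball_volumeE// -(haar_translation_invariant hl (- e)
    (@eball_measurable R d r)).
have : (lam (eball r `|` B) <= lam (eball M))%E.
  apply: le_measure; rewrite ?inE; [apply: measurableU => //;
    exact: eball_measurable|exact: eball_measurable|].
  move=> w [/= wr|]; first exact: le_trans rM.
  rewrite /B/= /eball/= => wr; apply: (le_trans (enorm_le_mx_norm w));
    apply: (@le_trans _ _ (d%:R * (ne + r))); last by rewrite lerDr ltW.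
  apply: ler_wpM2l => //.
  rewrite -(subrK e w) addrC (le_trans (ler_normD _ _))// lerD2l.
  exact: le_trans (mx_norm_le_enorm _) wr.
rewrite measureU//=; last 2 first.
- exact: eball_measurable.
- apply/seteqP; split=> // w [/= wr wB].
  have : ne <= `|w| + `|w - e|.
    by rewrite /ne -[e in leLHS](subrK w) addrC distrC ler_normD.
  have := le_trans (mx_norm_le_enorm _) wr; have :=
    le_trans (mx_norm_le_enorm _) wB.
  rewrite /r; lra.
rewrite lB !ball_volumeE// -EFinD lee_fin (VE r r0) (VE M M0) -g10 !powRr0.
by rewrite gerDl leNgt mulr1 V1.
Qed.

End BallVolumePower.

(** * Uniqueness of the rotation-invariant measure on the sphere *)

Definition rotation_invariant (R : realType) d (mu : set (borel 'rV[R]_d) ->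
  \bar R) :=
  forall (O : 'M[R]_d) (A : set (borel 'rV[R]_d)), O *m O^T = 1%:M ->
    measurable A ->
  mu ((fun v : 'rV[R]_d => v *m O) @^-1` A) = mu A.

Definition cap (R : realType) d (e : R) (w : 'rV[R]_d) : set 'rV[R]_d :=
  [set v | esphere v /\ enorm (v - w) < e].

Definition thickening (R : realType) d (e : R) (F : set 'rV[R]_d)
  : set 'rV[R]_d := [set v | exists2 w, F w & enorm (v - w) < e].

Lemma esphere_measurable (R : realType) d : measurable (@esphere R d : set
  (borel 'rV[R]_d)).
Proof. by apply: closed_borel_measurable; exact: esphere_closed. Qed.

Lemma enormN (R : realType) d (v : 'rV[R]_d) : enorm (- v) = enorm v.
Proof. by rewrite -scaleN1r enormZ normrN1 mul1r. Qed.

Lemma enormB_continuous (R : realType) d (w : 'rV[R]_d) : continuous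
  (fun v : 'rV[R]_d => enorm (v - w)).
Proof.
move=> v; apply: (@continuous_comp _ _ _ (fun v : 'rV[R]_d => v - w)
  (@enorm R d)); last exact: enorm_continuous.
apply: (@continuousB _ _ _ (fun v : 'rV[R]_d => v) (fun=> w));
  last exact: cst_continuous.
exact: cvg_id.
Qed.

Lemma enormB_open (R : realType) d (e : R) (w : 'rV[R]_d) : open [set v | enorm
  (v - w) < e].
Proof.
have := @open_comp _ _ (fun v : 'rV[R]_d => enorm (v - w)) [set x | x < e].
by apply; [move=> v _; exact: enormB_continuous|exact: open_lt].
Qed.

Lemma thickening_open (R : realType) d (e : R) (F : set 'rV[R]_d) : open
  (thickening e F).
Proof.
have -> : thickening e F = \bigcup_(w in F) [set v | enorm (v - w) < e].
  by apply/seteqP; split=> [v [w Fw vw]|v [w Fw vw]]; exists w.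
by apply: bigcup_open => w _; exact: enormB_open.
Qed.

Lemma cap_measurable (R : realType) d (e : R) (w : 'rV[R]_d) : measurable (cap e
  w : set (borel 'rV[R]_d)).
Proof.
apply: measurableI; first exact: esphere_measurable.
by apply: open_borel_measurable; exact: enormB_open.
Qed.

Lemma bigcap_thickening (R : realType) d (F : set 'rV[R]_d) : closed F ->
  \bigcap_k thickening k.+1%:R^-1 F = F.
Proof.
move=> cF; apply/seteqP; split=> [v hv|v Fv k _]; last first.
  by exists v => //; rewrite subrr -(scale0r 0) enormZ normr0 mul0r invr_gt0.
apply: cF => A /nbhs_ballP[e /= e0 eA].
have [n _ hn] := near_infty_natSinv_lt (PosNum e0).
have [w Fw vw] := hv n I; exists w; split=> //; apply: eA.
rewrite mx_norm_ball /ball_/=; apply: le_lt_trans (mx_norm_le_enorm _) _.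
by apply: lt_trans vw _; exact: (hn n (leqnn n)).
Qed.

Section CapMeasure.
Variables (R : realType) (d : nat) (mu : {measure set (borel 'rV[R]_d) ->
  \bar R}).
Hypothesis rmu : rotation_invariant mu.

Lemma cap_measure_const (e : R) v w : esphere v -> esphere w ->
  mu (cap e v) = mu (cap e w).
Proof.
move=> Sv Sw; have [|O OO vO] := @esphere_transitive R d v w;
  first by rewrite Sv Sw.
rewrite -(rmu OO (cap_measurable e w)); congr (mu _).
by apply/seteqP; split=> x; rewrite /cap /esphere/= -vO -mulmxBl
  !enorm_orthogonal.
Qed.

(** All caps of radius e have the same measure. If it were zero, countably many small rational
    pieces, each inside a cap, would make the sphere null. *)
Lemma cap_measure_gt0 (e : R) w : (0 < mu (@esphere R d))%E -> 0 < e ->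
  esphere w -> (0 < mu (cap e w))%E.
Proof.
move=> S0 e0 Sw; rewrite lt_neqAle measure_ge0 andbT eq_sym;
  apply/negP => /eqP c0.
have d1 : (0 : R) < d%:R + 1 by rewrite ltr_wpDl.
(* Two points of a sup ball of radius b are at sup distance less than e / (d + 1), hence at
   Euclidean distance less than e. The + 1 keeps the division sound when d = 0. *)
pose b := e / 2 / (d%:R + 1); have b0 : 0 < b by rewrite !divr_gt0.
pose W (q : 'rV[rat]_d) : set 'rV[R]_d :=
  esphere `&` ball (map_mx ratr q : 'rV[R]_d) b.
have mW q : measurable (W q : set (borel 'rV[R]_d)).
  apply: measurableI; first exact: esphere_measurable.
  by apply: open_borel_measurable; exact: ball_open.
have W0 q : mu (W q) = 0%E.
  have [->|/set0P[v [Sv qv]]] := eqVneq (W q) set0; first exact: measure0.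
  have cv : mu (cap e v) = 0%E by rewrite (cap_measure_const e Sv Sw).
  apply: (subset_measure0 (mW q) (cap_measurable e v) _ cv).
  move=> x [Sx qx]; split=> //; apply: le_lt_trans (enorm_le_mx_norm _) _.
  have : `|x - v| < b + b.
    have := ball_triangle (ball_sym qx) qv; by rewrite mx_norm_ball.
  have -> : b + b = e / (d%:R + 1) by rewrite /b; field; rewrite gt_eqF.
  rewrite ltr_pdivlMr// => h; apply: le_lt_trans h;
    rewrite mulrC ler_wpM2l// lerDl//.
pose W' n := if unpickle n is Some q then W q else set0.
have : mu.-negligible (\bigcup_n W' n).
  apply: negligible_bigcup => n; rewrite /W'; case: unpickle => [q|];
    last exact: negligible_set0.
  by exists (W q); split.
move=> [A [mA A0 WA]].
have : mu (@esphere R d) = 0%E.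
  apply: (subset_measure0 (@esphere_measurable R d) mA _ A0) => v Sv; apply: WA.
  have [q vq] := rat_approx_rV v b0.
  by exists (pickle q) => //; rewrite /W' pickleK; split => //; exact: ball_sym.
by move=> h; rewrite h ltxx in S0.
Qed.

End CapMeasure.

Section CapCompare.
Variables (R : realType) (d : nat) (mu nu : {sigma_finite_measure set (borel
  'rV[R]_d) -> \bar R}).
Hypotheses (rmu : rotation_invariant mu) (rnu : rotation_invariant nu).
Local Notation S := (@esphere R d).

(* Tonelli on {(v, w) | v in F, |v - w| < e}, as in Christensen's proof that
   uniformly distributed measures are proportional. *)
Lemma cap_compare (e : R) w (F : set 'rV[R]_d) : S w -> closed F ->
  (nu (cap e w) * mu (F `&` S) <= mu (cap e w) * nu (thickening e F `&` S))%E.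
Proof.
move=> Sw cF.
pose P : set (borel 'rV[R]_d * borel 'rV[R]_d) := [set z | [/\
  S z.1, F z.1, S z.2 & enorm ((z.1 : 'rV[R]_d) - z.2) < e]].
have mF : measurable (F `&` S : set (borel 'rV[R]_d)).
  by apply: measurableI; [exact: closed_borel_measurable|exact:
    esphere_measurable].
have mT : measurable (thickening e F `&` S : set (borel 'rV[R]_d)).
  by apply: measurableI; [apply: open_borel_measurable;
    exact: thickening_open|exact: esphere_measurable].
have mP : measurable P.
  have -> : P = ((F `&` S) `*` S) `&` [set z : 'rV[R]_d * 'rV[R]_d | enorm (z.1
    - z.2) < e].
    by apply/seteqP; split=> z /= => [[]|[[[]]]].
  apply: measurableI; first by apply: measurableX => //;
    exact: esphere_measurable.
  apply: open_prod_measurable.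
  have := @open_comp _ _ (fun z : 'rV[R]_d * 'rV[R]_d => enorm (z.1 - z.2)) [set
    x | x < e].
  apply; last exact: open_lt.
  move=> z _; apply: (@continuous_comp _ _ _ (fun z : 'rV[R]_d * 'rV[R]_d => z.1
    - z.2) (@enorm R d)); last exact: enorm_continuous.
  exact: sub_continuous.
have <- : (\int[mu]_x nu (xsection P x) = nu (cap e w) * mu (F `&` S))%E.
  apply: integral_cst_on => // x; rewrite /xsection /P/=.
    move=> [Fx Sx]; rewrite -(cap_measure_const rnu e Sx Sw); congr (nu _);
      apply/seteqP; split=> y /=; rewrite inE/= /cap/=.
      by case=> _ _ Sy; rewrite -enormN opprB.
    by case=> Sy; rewrite -enormN opprB.
  move=> nFx; rewrite [X in nu X](_ : _ = set0) ?measure0//; apply/seteqP;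
    split=> y //=; rewrite inE/= => -[Sx Fx _ _].
  exact: nFx.
rewrite tonelli_sections//.
rewrite -(@integral_cst_on _ _ _ nu _ ((fun=> mu (cap e w)) \_ (thickening e F
  `&` S))) //; last 2 first.
- by move=> y /mem_set yT; rewrite patchE yT.
- by move=> y yT; rewrite patchE; case: ifPn => // /set_mem.
apply: ge0_le_integral => //.
- exact: measurable_fun_ysection.
- by apply/(measurable_restrictT _ mT); exact: measurable_cst.
(* The section at y is contained in the cap about y, and is empty unless y is on the sphere and
   within e of F. *)
move=> y _; rewrite patchE; case: ifPn => [/set_mem [Ty Sy]|/negP yT].
  rewrite -(cap_measure_const rmu e Sy Sw); apply: le_measure; rewrite ?inE.
  - exact: measurable_ysection.
  - exact: cap_measurable.
  by move=> x; rewrite /ysection /P/= inE/= => -[].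
suff -> : mu (ysection P y) = 0%E by [].
rewrite [X in mu X](_ : _ = set0) ?measure0//; apply/seteqP; split=> x //=;
  rewrite /ysection /P/= inE/= => -[Sx Fx Sy xy].
by apply: yT; apply/mem_set; split=> //; exists x => //; rewrite -enormN opprB.
Qed.

End CapCompare.

Section SphereUnique.
Variables (R : realType) (d : nat) (mu nu : {measure set (borel 'rV[R]_d) ->
  \bar R}).
Hypotheses (rmu : rotation_invariant mu) (rnu : rotation_invariant nu).
Hypotheses (mufin : (mu setT < +oo)%E) (nufin : (nu setT < +oo)%E).
Local Notation S := (@esphere R d).
Hypothesis nuS : nu S = 1%E.

Lemma finite_sigma_finite (m : {measure set (borel 'rV[R]_d) ->
  \bar R}) : (m setT < +oo)%E -> sigma_finite setT m.
Proof. by move=> mfin; exists (fun=> setT) => //; rewrite bigcup_const//;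
  exists 0%N. Qed.

Lemma finite_measureE (m : {measure set (borel 'rV[R]_d) ->
  \bar R}) A : (m setT < +oo)%E -> measurable A -> m A = (fine (m A))%:E.
Proof.
move=> mfin mA; rewrite fineK// ge0_fin_numE//; apply: le_lt_trans mfin.
by apply: le_measure; rewrite ?inE.
Qed.

Lemma cvg_thickening (m : {measure set (borel 'rV[R]_d) ->
  \bar R}) F : (m setT < +oo)%E -> closed F ->
  (m (thickening k.+1%:R^-1 F `&` S) @[k --> \oo] --> m (F `&` S))%E.
Proof.
move=> mfin cF.
have mT k : measurable (thickening k.+1%:R^-1 F `&` S : set (borel 'rV[R]_d)).
  by apply: measurableI; [apply: open_borel_measurable;
    exact: thickening_open|exact: esphere_measurable].
have E : \bigcap_k (thickening k.+1%:R^-1 F `&` S) = F `&` S.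
  have hT := bigcap_thickening cF; apply/seteqP; split=> [v h|v [Fv Sv] k _].
    split; last by have [] := h 0%N I.
    by rewrite -hT => k _; have [] := h k I.
  split=> //; have : (\bigcap_k thickening k.+1%:R^-1 F) v by rewrite hT.
  exact.
rewrite -E; apply: nonincreasing_cvg_mu => //.
- by rewrite (finite_measureE mfin)// ltry.
- by rewrite E; apply: measurableI; [exact: closed_borel_measurable|exact:
  esphere_measurable].
- move=> i j ij; apply/subsetPset; apply: setSI => v [w Fw vw]; exists w => //.
  by apply: lt_le_trans vw _; rewrite lef_pV2 ?posrE// ler_nat.
Qed.

(** For every e the ratio of the cap measures of [mu] and [nu] is the constant [mu S]. Dividing
    [cap_compare] by the cap measure leaves inequalities between F and its thickening, in both
    directions, and e tends to 0. *)
Lemma sphere_measure_unique_closed F : closed F ->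
  mu (F `&` S) = (mu S * nu (F `&` S))%E.
Proof.
move=> cF.
have [Se|/set0P[w Sw]] := eqVneq S set0.
  by rewrite Se !setI0 !measure0 mule0.
have [mu' mu'E] := exists_sigma_finite_measure (finite_sigma_finite mufin).
have [nu' nu'E] := exists_sigma_finite_measure (finite_sigma_finite nufin).
have rmu' : rotation_invariant mu' by rewrite mu'E.
have rnu' : rotation_invariant nu' by rewrite nu'E.
have mS : measurable (S : set (borel 'rV[R]_d)) by exact: esphere_measurable.
have mF : measurable (F `&` S : set (borel 'rV[R]_d)) by apply: measurableI =>
  //; exact: closed_borel_measurable.
have mT e : measurable (thickening e F `&` S : set (borel 'rV[R]_d)).
  by apply: measurableI => //; apply: open_borel_measurable;
    exact: thickening_open.
have TT e : 0 < e -> thickening e [set: 'rV[R]_d] = setT.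
  move=> e0; apply/seteqP; split=> // v _; exists v => //.
  by rewrite subrr -(scale0r 0) enormZ normr0 mul0r.
have key e : 0 < e -> (mu (F `&` S) <= mu S * nu (thickening e F `&` S) /\
  mu S * nu (F `&` S) <= mu (thickening e F `&` S))%E.
  move=> e0.
  have a0 : (0 < nu (cap e w))%E by apply: cap_measure_gt0 => //; rewrite nuS.
  have := cap_compare rmu' rnu' e Sw cF; have := cap_compare rnu' rmu' e Sw cF.
  (* The whole space is its own thickening, so the comparison in both directions gives the ratio
     exactly. *)
  have := cap_compare rmu' rnu' e Sw closedT; have :=
    cap_compare rnu' rmu' e Sw closedT.
  rewrite mu'E nu'E TT// !setTI nuS mule1 => h1 h2.
  have {h1 h2} -> : mu (cap e w) = (nu (cap e w) * mu S)%E by apply: le_anti;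
    rewrite h1 h2.
  have af : nu (cap e w) \is a fin_num by rewrite (finite_measureE nufin)//;
    exact: cap_measurable.
  by rewrite -!muleA !lee_pmul2l.
have cm : (mu S * nu (thickening k.+1%:R^-1 F `&` S) @[k --> \oo] -->
  mu S * nu (F `&` S))%E.
  by apply: cvgeZl; [rewrite (finite_measureE mufin)|exact: cvg_thickening].
apply: le_anti; apply/andP; split.
  apply: cvge_to_ge cm _; apply: nearW => k.
  by have [] := key k.+1%:R^-1 _; rewrite ?invr_gt0.
apply: cvge_to_ge (cvg_thickening mufin cF) _; apply: nearW => k.
by have [] := key k.+1%:R^-1 _; rewrite ?invr_gt0.
Qed.

(** Closed sets are stable under intersection and generate the Borel sets, so agreement on them
    suffices. As both measures are carried by S, the mass of S is the total mass. *)
Lemma sphere_measure_unique (A : set (borel 'rV[R]_d)) : mu (~` S) = 0%E ->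
  nu (~` S) = 0%E -> measurable A ->
  mu A = (mu setT * nu A)%E.
Proof.
move=> muS nuSC mA.
have mS : measurable (S : set (borel 'rV[R]_d)) by exact: esphere_measurable.
have restrS (m : {measure set (borel 'rV[R]_d) -> \bar R}) B : m (~` S) = 0%E ->
  measurable B -> m B = m (B `&` S).
  move=> mS0 mB; rewrite -[in LHS](setIT B) -(setUv S) setIUr measureU//.
  - by rewrite [X in (_ + X)%E](_ : _ = 0%E) ?adde0//;
    apply: (subset_measure0 _ _ _ mS0) => //; [apply: measurableI|];
    try exact: measurableC.
  - exact: measurableI.
  - by apply: measurableI => //; exact: measurableC.
  - by rewrite setIACA setICr setI0.
pose c : {nonneg R} := NngNum (fine_ge0 (measure_ge0 mu setT)).
pose nu' : {measure set (borel 'rV[R]_d) -> \bar R} := mscale c nu.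
have E B : measurable B -> nu' B = (mu setT * nu B)%E.
  by move=> mB; rewrite /nu' /= /mscale/= [in RHS](finite_measureE mufin).
rewrite -E//.
apply: (@measure_unique _ R (borel 'rV[R]_d) (@closed 'rV[R]_d)
  (fun=> setT) _ _ _ _ mu nu') => //.
- apply/seteqP; split.
    apply: smallest_sub => [|U oU]; first exact: smallest_sigma_algebra.
    rewrite -(setCK U); apply: (@measurableC _ (g_sigma_algebraType (@closed
      'rV[R]_d))).
    by apply: sub_sigma_algebra; exact: open_closedC.
  apply: smallest_sub => [|F cF]; first exact: sigma_algebra_measurable.
  exact: closed_borel_measurable.
- by move=> F1 F2; exact: closedI.
- by rewrite bigcup_const//; exists 0%N.
- move=> F cF; have mF : measurable (F : set (borel 'rV[R]_d))
  by exact: closed_borel_measurable.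
  have muT : mu setT = mu S by rewrite (restrS mu _ muS measurableT) setTI.
  by rewrite E// (restrS mu _ muS mF) (restrS nu _ nuSC mF)
    sphere_measure_unique_closed// muT.
Qed.

End SphereUnique.

(** * Polar coordinates *)

Lemma continuous_compose (T U W : topologicalType) (f : T -> U) (g : U ->
  W) : continuous f -> continuous g -> continuous (fun x => g (f x)).
Proof. by move=> cf cg x; exact: continuous_comp (cf x) (cg _). Qed.

Lemma compact_bounded_fun (R : realType) (T : topologicalType) (K : set T)
  (h : T -> R) : compact K -> continuous h ->
  exists2 M, 0 <= M & forall v, K v -> `|h v| <= M.
Proof.
move=> cK ch; have : compact (h @` K) by apply: continuous_compact => //;
  exact: continuous_subspaceT.
move=> /compact_bounded [M [_ hM]]; exists (`|M| + 1);
  first by rewrite addr_ge0.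
move=> v Kv; apply: hM; last by exists v.
by rewrite (le_lt_trans (ler_norm M))// ltrDl.
Qed.

Lemma compact_integrable (R : realType) d (mu : {measure set (borel 'rV[R]_d) ->
  \bar R}) (K : set 'rV[R]_d) (h : 'rV[R]_d -> R) :
  compact K -> (mu K < +oo)%E -> continuous h -> mu.-integrable K (EFin \o h).
Proof.
move=> cK muK ch.
have mK : measurable (K : set (borel 'rV[R]_d)).
  by apply: closed_borel_measurable; apply: compact_closed => //;
    exact: norm_hausdorff.
apply: measurable_bounded_integrable => //.
  by apply: measurable_funTS; exact: continuous_borel_measurableR.
have [M M0 hM] := compact_bounded_fun cK ch.
by exists M; split=> [|N MN v Kv /=]; rewrite ?num_real// (le_trans (hM v Kv))//
  ltW.
Qed.

(** Joint continuity of (w, s) |-> h (s w) at each point (w, c) becomes uniform in w because the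
    sphere is compact. *)
Lemma near_sphere (R : realType) d (h : 'rV[R]_d ->
  R) (c e : R) : continuous h -> 0 < e ->
  \forall s \near c, forall w, esphere w -> `|h (s *: w) - h (c *: w)| < e.
Proof.
move=> ch e0.
have := (@compact_near_coveringP _ (@esphere R d)).1 (@esphere_compact R d) R
  (nbhs c) (fun s w => `|h (s *: w) - h (c *: w)| < e) _.
apply => w _.
pose k (z : 'rV[R]_d * R) := h (z.2 *: z.1) - h (c *: z.1).
have k1 : {for (w, c), continuous (fun z : 'rV[R]_d * R => z.2 *: z.1)}.
  by apply: cvgZ; [exact: cvg_snd|exact: cvg_fst].
have k2 : {for (w, c), continuous (fun z : 'rV[R]_d * R => c *: z.1)}.
  by apply: cvgZr; exact: cvg_fst.
have ck : {for (w, c), continuous k}.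
  exact: continuousB (continuous_comp k1 (ch _)) (continuous_comp k2 (ch _)).
have /cvgrPdist_lt/(_ e e0) := ck.
by apply: filterS => -[v s] /=; rewrite /k/= subrr sub0r normrN.
Qed.

Section Sphere.
Variables (R : realType) (d : nat) (sigma : probability (borel 'rV[R]_d) R).
Hypothesis hs : is_sphere_measure sigma.
Local Notation S := (@esphere R d).

Lemma sphere_measure_setC : sigma (~` S) = 0%E.
Proof. by rewrite probability_setC ?hs.1 ?subee//;
  exact: esphere_measurable. Qed.

Lemma sphere_measure_rotation : rotation_invariant sigma.
Proof.
move=> O A OO mA; have OtO : O^T *m O = 1%:M by rewrite mulmx1C.
rewrite -(hs.2 O^T A) ?trmxK//; congr (sigma _); apply/seteqP;
  split=> [v /= Av|_ [v Av <-]/=].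
  by exists (v *m O) => //; rewrite -mulmxA OO mulmx1.
by rewrite -mulmxA OtO mulmx1.
Qed.

Lemma sphere_nonempty : exists v, @esphere R d v.
Proof.
have [S0|/set0P//] := eqVneq S set0.
by have := hs.1; rewrite S0 measure0 => /eqP; rewrite eq_sym onee_eq0.
Qed.

Variable h : 'rV[R]_d -> R.
Hypothesis ch : continuous h.

Definition sphere_mean (s : R) : R := \int[sigma]_(w in S) h (s *: w).

Lemma dilate_continuous (s : R) : continuous (fun w : 'rV[R]_d => h (s *: w)).
Proof.
have k : continuous (fun w : 'rV[R]_d => w *m s%:M).
  by apply: continuous_mulmxr => x; exact: cvg_id.
rewrite (_ : (fun w => h (s *: w)) = (fun w => h (w *m s%:M)));
  first exact: continuous_compose k ch.
by apply/funext => w; rewrite mul_mx_scalar.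
Qed.

Lemma sphere_integrable (g : 'rV[R]_d -> R) : continuous g ->
  sigma.-integrable S (EFin \o g).
Proof.
move=> cg; apply: compact_integrable => //; first exact: esphere_compact.
by apply: le_lt_trans (probability_le1 _ _) (ltry 1); exact: esphere_measurable.
Qed.

Lemma sphere_mean_near (s c e : R) : (forall w, S w ->
  `|h (s *: w) - h (c *: w)| <= e) ->
  `|sphere_mean s - sphere_mean c| <= e.
Proof.
move=> he; rewrite /sphere_mean -RintegralB//;
  [|exact: esphere_measurable|exact/sphere_integrable/dilate_continuous..].
have cd : continuous (fun w : 'rV[R]_d => h (s *: w) - h (c *: w)).
  by move=> w; apply: continuousB; exact: dilate_continuous.
have cdn : continuous (fun w : 'rV[R]_d => `|h (s *: w) - h (c *: w)|).
  by move=> w; apply: (@continuous_comp _ _ _ (fun w : 'rV[R]_d => h (s *: w) -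
    h (c *: w)) Num.norm); [exact: cd|exact: norm_continuous].
apply: le_trans (le_normr_Rintegral _ _) _; [exact: esphere_measurable|exact:
  sphere_integrable|].
apply: (@le_trans _ _ (\int[sigma]_(w in S) e)).
  apply: le_Rintegral => //; [exact: esphere_measurable|exact:
    sphere_integrable|].
  by apply: sphere_integrable; exact: cst_continuous.
rewrite Rintegral_cst; last exact: esphere_measurable.
by rewrite (_ : fine _ = 1) ?mulr1//; exact: (congr1 fine hs.1).
Qed.

Lemma sphere_mean_continuous : continuous sphere_mean.
Proof.
move=> c; apply/cvgrPdist_le => e e0.
have := near_sphere c ch e0; apply: filterS => s hse.
by rewrite distrC; apply: sphere_mean_near => w Sw; apply/ltW/hse.
Qed.

End Sphere.

(** * Radial projection of spherical shells *)

Section Shell.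
Variables (R : realType) (d : nat) (lam : {measure set (borel 'rV[R]_d) ->
  \bar R}) (sigma : probability (borel 'rV[R]_d) R).
Hypotheses (hl : is_haar_Rd lam) (hs : is_sphere_measure sigma).
Local Notation S := (@esphere R d).
Local Notation V := (ball_volume lam).

Definition shell (a b : R) : set 'rV[R]_d := eball b `\` eball a.

(* v / |v| on the shell a < |v| <= b; the maximum only serves continuity
   at 0. *)
Definition radial (a : R) (v : 'rV[R]_d) : 'rV[R]_d :=
  (Num.max (enorm v) a)^-1 *: v.

Lemma shell_measurable a b : measurable (shell a b : set (borel 'rV[R]_d)).
Proof. by apply: measurableD; exact: eball_measurable. Qed.

Lemma eball_shell a b : a <= b -> eball b = eball a `|` shell a b :> set
  'rV[R]_d.
Proof.
move=> ab; rewrite setDUK// => v /= va; exact: le_trans ab.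
Qed.

Lemma shell_measure a b : a <= b -> lam (shell a b) = (V b - V a)%:E.
Proof.
move=> ab; have : lam (eball b) = (lam (eball a) + lam (shell a b))%E.
  rewrite (eball_shell ab) measureU//; [exact: eball_measurable|exact:
    shell_measurable|by rewrite setDIK].
by rewrite !ball_volumeE// EFinB => ->; rewrite addeAC subee// add0e.
Qed.

Lemma radial_continuous a : 0 < a -> continuous (radial a).
Proof.
move=> a0 v.
have m0 : Num.max (enorm v) a != 0 by rewrite gt_eqF// lt_max a0 orbT.
have cm : {for v, continuous (fun v : 'rV[R]_d => Num.max (enorm v) a)}.
  by apply: continuous_max; [exact: enorm_continuous|exact: cst_continuous].
have ci : {for v, continuous (fun v : 'rV[R]_d => (Num.max (enorm v) a)^-1)}
  by exact: continuousV.
by apply: (cvgZ ci); exact: cvg_id.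
Qed.

Lemma radialE a v : 0 < a -> a < enorm v -> radial a v = (enorm v)^-1 *: v.
Proof. by move=> a0 av; rewrite /radial max_l// ltW. Qed.

Lemma radial_shell a b v : 0 < a -> shell a b v -> S (radial a v) /\
  v = enorm v *: radial a v.
Proof.
move=> a0 [vb /negP]; rewrite -ltNge => av; rewrite radialE//.
have v0 : 0 < enorm v by exact: lt_trans av.
split; last by rewrite scalerA divff ?scale1r// gt_eqF.
by rewrite /esphere/= enormZ gtr0_norm ?invr_gt0// mulVf// gt_eqF.
Qed.

Lemma radial_orthogonal a (O : 'M[R]_d) v : O *m O^T = 1%:M ->
  radial a (v *m O) = radial a v *m O.
Proof. by move=> OO; rewrite /radial enorm_orthogonal// scalemxAl. Qed.

(** The image of [lam] on the shell under radial projection is finite, carried by the sphere and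
    rotation invariant, since projection commutes with orthogonal maps. Uniqueness makes it a
    multiple of [sigma], and the total mass gives the factor. *)
Lemma radial_pushforward a b (A : set (borel 'rV[R]_d)) : 0 < a -> a <= b ->
  measurable A ->
  lam (shell a b `&` radial a @^-1` A) = ((V b - V a)%:E * sigma A)%E.
Proof.
move=> a0 ab mA.
pose nu : {measure set (borel 'rV[R]_d) -> \bar R} :=
  mrestr lam (shell_measurable a b).
have [mu muE] := exists_pushforward_measure nu (continuous_borel_measurable
  (radial_continuous a0)).
have E B : mu B = lam (shell a b `&` radial a @^-1` B) by rewrite muE /nu/=
  /mrestr setIC.
have muT : mu setT = (V b - V a)%:E by rewrite E preimage_setT setIT
  shell_measure.
rewrite -E -muT; apply: sphere_measure_unique => //.
- move=> O B OO mB; rewrite !E -[RHS](haar_rotation hl OO).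
    congr (lam _); apply/seteqP; split=> v;
      rewrite /shell /eball/= radial_orthogonal// enorm_orthogonal//.
  apply: measurableI; first exact: shell_measurable.
  exact: measurable_preimage (radial_continuous a0) mB.
- exact: sphere_measure_rotation.
- by rewrite muT ltry.
- by apply: le_lt_trans (probability_le1 _ _) (ltry 1).
- exact: hs.1.
- rewrite E [X in lam X](_ : _ = set0) ?measure0//; apply/seteqP;
  split=> // v [/(radial_shell a0)[]].
  by [].
- exact: sphere_measure_setC.
Qed.

Lemma ge0_shell_integral a b (g : 'rV[R]_d -> R) : 0 < a -> a <= b ->
  continuous g -> (forall w, S w -> 0 <= g w) ->
  (\int[lam]_(v in shell a b) (g (radial a v))%:E = (V b - V a)%:E *
    \int[sigma]_(w in S) (g w)%:E)%E.
Proof.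
move=> a0 ab cg g0.
have mS : measurable (S : set (borel 'rV[R]_d)) by exact: esphere_measurable.
have msh := shell_measurable a b.
have mr := continuous_borel_measurable (radial_continuous a0).
have mg : measurable_fun setT (g : borel 'rV[R]_d ->
  R) by exact: continuous_borel_measurableR.
have Vab : 0 <= V b - V a by rewrite subr_ge0 ball_volume_le.
pose nu : {measure set (borel 'rV[R]_d) -> \bar R} := mrestr lam msh.
have [mu muE] := exists_pushforward_measure nu mr.
have E B : mu B = lam (shell a b `&` radial a @^-1` B) by rewrite muE /nu/=
  /mrestr setIC.
transitivity (\int[mu]_(w in S) (g w)%:E)%E.
  transitivity (\int[nu]_(v in shell a b) (g (radial a v))%:E)%E.
    by apply: eq_measure_integral => A mA As; rewrite /nu/= /mrestr setIidl.
  rewrite muE (ge0_integral_pushforward mr nu mS); last 2 first.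
  - by apply/measurable_EFinP; exact: measurable_funTS.
  - by move=> y /set_mem Sy; rewrite lee_fin g0.
  have mD : measurable (radial a @^-1` S : set (borel 'rV[R]_d))
    by exact: measurable_preimage (radial_continuous a0) mS.
  have sD : shell a b `<=` radial a @^-1` S by move=> v /(radial_shell a0)[].
  (* The preimage of the sphere may exceed the shell, but the excess is null for [nu], which lives
     on the shell. *)
  rewrite (@ge0_negligible_integral _ _ _ nu (radial a @^-1` S)
    ((radial a @^-1` S) `\` shell a b)) ?setDD ?setIidr//.
  - exact: measurableD.
  - apply: measurable_funTS; apply/measurable_EFinP.
    exact: (measurableT_comp mg mr).
  - by move=> v Sv; rewrite lee_fin g0.
  - by rewrite /nu/= /mrestr setDKI measure0.
rewrite -(ge0_integral_mscale sigma mS (NngNum Vab)); last 2 first.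
- by apply/measurable_EFinP; exact: measurable_funTS.
- by move=> y Sy; rewrite lee_fin g0.
by apply: eq_measure_integral => A mA As; rewrite E radial_pushforward.
Qed.

End Shell.

Section Polar.
Variables (R : realType) (d : nat) (lam : {measure set (borel 'rV[R]_d) ->
  \bar R}) (sigma : probability (borel 'rV[R]_d) R).
Hypotheses (hl : is_haar_Rd lam) (hs : is_sphere_measure sigma).
Local Notation S := (@esphere R d).
Local Notation V := (ball_volume lam).

Lemma eball_integrable b (g : 'rV[R]_d -> R) : continuous g ->
  lam.-integrable (eball b) (EFin \o g).
Proof.
move=> cg; apply: compact_integrable => //; first exact: eball_compact.
by rewrite ball_volumeE// ltry.
Qed.

Lemma shell_integrable a b (g : 'rV[R]_d -> R) : continuous g ->
  lam.-integrable (shell a b) (EFin \o g).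
Proof.
move=> cg; apply: (integrableS _ _ _ (eball_integrable b cg));
  [exact: eball_measurable|exact: shell_measurable|].
by move=> v [].
Qed.

Lemma fine_shell_measure a b : a <= b -> fine (lam (shell a b)) = V b - V a.
Proof. by move=> ab; rewrite shell_measure. Qed.

(** The nonnegative case is applied to g + M, where M bounds |g| on the sphere. The constant
    contributes M (V b - V a) to both sides. *)
Lemma shell_integral a b (g : 'rV[R]_d -> R) : 0 < a -> a <= b ->
  continuous g ->
  \int[lam]_(v in shell a b) g (radial a v) = (V b - V a) * \int[sigma]_(w in S)
    g w.
Proof.
move=> a0 ab cg.
have [M M0 hM] := compact_bounded_fun (@esphere_compact R d) cg.
have cgM : continuous (fun w => g w + M).
  by move=> w; apply: continuousD; [exact: cg|exact: cst_continuous].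
have gM0 w : S w -> 0 <= g w + M.
  by move=> Sw; rewrite -lerBlDr sub0r; have := hM w Sw;
    rewrite ler_norml => /andP[].
have cr : continuous (fun v => g (radial a v)).
  exact: continuous_compose (radial_continuous a0) cg.
have := congr1 fine (ge0_shell_integral hl hs a0 ab cgM gM0).
have fin : (\int[sigma]_(w in S) (g w + M)%:E)%E \is a fin_num.
  by apply: integrable_fin_num; [exact: esphere_measurable|exact:
    sphere_integrable].
rewrite fineM//= -!/(Rintegral _ _ _).
rewrite !RintegralD//.
- rewrite !Rintegral_cst ?fine_shell_measure//;
  [|exact: esphere_measurable|exact: shell_measurable].
  rewrite (_ : fine (sigma S) = 1); last exact: (congr1 fine hs.1).
  by move=> e; apply: (addIr (M * (V b - V a))); rewrite e; ring.
- exact: esphere_measurable.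
- exact: sphere_integrable.
- by apply: sphere_integrable => //; exact: cst_continuous.
- exact: shell_measurable.
- exact: shell_integrable.
- by apply: shell_integrable; exact: cst_continuous.
Qed.

(** * Differentiation in the radius and integration by parts *)

Variable h : 'rV[R]_d -> R.
Hypothesis ch : continuous h.

Definition ball_integral (s : R) : R := \int[lam]_(v in eball s) h v.

Local Notation F := ball_integral.
Local Notation H := (sphere_mean sigma h).

Lemma ball_integralB a b : a <= b -> F b - F a = \int[lam]_(v in shell a b) h v.
Proof.
move=> ab; rewrite /ball_integral [X in \int[_]_(_ in X) _](eball_shell d ab)
  Rintegral_setU.
- by rewrite addrC addKr.
- exact: eball_measurable.
- exact: shell_measurable.
- by rewrite -eball_shell//; exact: eball_integrable.
- by apply/disj_setPS => v [va [_]].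
Qed.

Lemma shell_estimate a b c eta : 0 < a -> a <= b ->
  (forall s w, a < s <= b -> S w -> `|h (s *: w) - h (c *: w)| <= eta) ->
  `|F b - F a - H c * (V b - V a)| <= eta * (V b - V a).
Proof.
move=> a0 ab he.
have cc := @dilate_continuous _ _ h ch c.
have cr : continuous (fun v => h (c *: radial a v)).
  exact: continuous_compose (radial_continuous a0) cc.
have cd : continuous (fun v => h v - h (c *: radial a v)).
  by move=> v; apply: continuousB; [exact: ch|exact: cr].
have cdn : continuous (fun v => `|h v - h (c *: radial a v)|).
  by apply: (continuous_compose cd) => x; exact: norm_continuous.
have msh := @shell_measurable R d a b.
rewrite ball_integralB// mulrC /sphere_mean -shell_integral// -RintegralB//;
  try exact: shell_integrable.
apply: le_trans (le_normr_Rintegral _ _) _ => //; first exact: shell_integrable.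
apply: (@le_trans _ _ (\int[lam]_(v in shell a b) eta)).
  apply: le_Rintegral => //;
    [exact: shell_integrable|by apply: shell_integrable;
    exact: cst_continuous|].
  move=> v shv; have [Sr vE] := radial_shell a0 shv.
  rewrite {1}vE; apply: he => //; case: shv => /= vb /negP;
    rewrite -ltNge => ->.
  by rewrite vb.
by rewrite Rintegral_cst// fine_shell_measure.
Qed.

Variables (al : R).
Hypothesis Vpow : forall s, 0 < s -> V s = V 1 * s `^ al.

Lemma ball_volume_derive (c : R) : 0 < c -> is_derive (c : R) 1 (V : R ->
  R) (V 1 * (al * c `^ (al - 1))).
Proof.
move=> c0.
have hd : is_derive (c : R) 1 (fun s : R => V 1 * s `^ al) (V 1 * (al * c `^ (al
  - 1))).
  by apply: is_deriveZ; exact: is_derive1_powR.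
apply: near_eq_is_derive hd.
near=> s; apply/esym/Vpow; near: s; exact: lt_nbhsr.
Unshelve. all: end_near.
Qed.

(* On a thin shell around the sphere of radius c, h v is uniformly close to
   h (c v / |v|), whose integral over the shell is exact. *)
Lemma ball_integral_derive (c : R) : 0 < c -> is_derive (c : R) 1 (F : R ->
  R) (H c * (V 1 * (al * c `^ (al - 1)))).
Proof.
move=> c0.
have dV := ball_volume_derive c0.
set dv := V 1 * _ in dV *.
have cV : (fun t : R => t^-1 *: ((V \o shift c) (t *: 1) - V c)) t @[t -->
  0^'] --> dv.
  by have [dvV <-] := dV; exact: dvV.
(* The difference quotient of F minus H c times that of V. Once it tends to 0, the derivative of F
   follows from that of V. *)
pose E (t : R) := t^-1 *: (F (t + c) - F c - H c * (V (t + c) - V c)).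
have cE : E t @[t --> 0^'] --> 0.
  apply/cvgrPdist_le => e e0.
  pose B := `|dv| + 1; have B0 : 0 < B by rewrite ltr_wpDl.
  have /nbhs_ballP[r /= r0 hr] := near_sphere c ch (divr_gt0 e0 B0).
  (* The oscillation of h on the shell, at most e / B, gets multiplied by this quotient, so a bound
     B on it leaves at most e. *)
  have Vlip : \forall t \near (0:R)^', `|t^-1 * (V (t + c) - V c)| <= B.
    have /cvgrPdist_lt/(_ 1 ltr01) := cV; apply: filterS => t.
    rewrite /GRing.scale/= mulr1 => h1; rewrite -[X in `|X|](subrK dv) addrC
      (le_trans (ler_normD _ _))//.
    by rewrite lerD2l distrC ltW.
  near=> t; rewrite sub0r normrN /E.
  have Vt : `|t^-1 * (V (t + c) - V c)| <= B by near: t.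
  have tr : `|t| < r by near: t; apply: dnbhs0_lt.
  have tc : `|t| < c by near: t; apply: dnbhs0_lt.
  suff main : `|F (t + c) - F c - H c * (V (t + c) - V c)| <= e / B * `|V (t +
    c) - V c|.
    rewrite /GRing.scale/= normrM (le_trans (ler_wpM2l _ main))// mulrCA
      -normrM.
    by rewrite (le_trans (ler_wpM2l _ Vt)) ?divfK ?gt_eqF// divr_ge0// ltW.
  have close s : `|c - s| < r -> forall w, S w -> `|h (s *: w) - h (c *: w)| <=
    e / B.
    by move=> cs w Sw; apply/ltW/hr.
  move: tc; rewrite ltr_norml => /andP[tc1 tc2].
  move: tr; rewrite ltr_norml => /andP[tr1 tr2].
  have [t0|t0] := leP 0 t.
    rewrite [`|V (t + c) - V c|]ger0_norm ?subr_ge0 ?ball_volume_le ?lerDr//.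
    apply: shell_estimate; rewrite ?lerDr// => s w /andP[s1 s2]; apply: close.
    by rewrite ltr_norml; apply/andP; split; lra.
  (* For t < 0 the shell runs from t + c, positive because |t| < c, up to c. The estimate is used
     with its endpoints exchanged. *)
  rewrite [`|V (t + c) - V c|]ler0_norm ?subr_le0 ?ball_volume_le ?gerDr ?(ltW
    t0)// opprB.
  have -> : F (t + c) - F c - H c * (V (t + c) - V c) = - (F c - F (t + c) - H c
    * (V c - V (t + c))) by ring.
  rewrite normrN.
  apply: shell_estimate; rewrite ?gerDr ?(ltW t0)//; first lra.
  move=> s w /andP[s1 s2]; apply: close.
  by rewrite ltr_norml; apply/andP; split; lra.
have cF : (fun t : R => t^-1 *: ((F \o shift c) (t *: 1) - F c)) t @[t -->
  0^'] --> H c * dv.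
  rewrite -[H c * dv]add0r.
  rewrite (_ : (fun t => _) = (fun t => E t + H c *: (t^-1 *: ((V \o shift c)
    (t *: 1) - V c)))).
    by apply: cvgD => //; apply: cvgZr.
  apply/funext => t; rewrite /E /= [t *: 1]mulr1 /GRing.scale/=; ring.
split; first by apply/cvg_ex; exists (H c * dv).
by apply/cvg_lim.
Unshelve. all: end_near.
Qed.

Hypothesis al0 : 0 < al.

Lemma powR_opp_le (a s g : R) : 0 < a -> a <= s -> 0 <= g ->
  s `^ (- g) <= a `^ (- g).
Proof.
move=> a0 as0 g0; have s0 : 0 < s := lt_le_trans a0 as0.
by rewrite !powRN lef_pV2 ?posrE ?powR_gt0// ge0_ler_powR// nnegrE ltW.
Qed.

Lemma derivable_continuous_at (g : R -> R) (x dg : R) : is_derive (x : R) 1 g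
  dg -> {for x, continuous g}.
Proof. by move=> [dgx _]; apply: differentiable_continuous;
  exact/derivable1_diffP. Qed.

Lemma ball_volume_integral_derive (c : R) : 0 < c ->
  is_derive (c : R) 1 (V : R -> R) (al * V c / c) /\
    is_derive (c : R) 1 (F : R -> R) (H c * (al * V c / c)).
Proof.
move=> c0; have <- : V 1 * (al * c `^ (al - 1)) = al * V c / c.
  by rewrite (Vpow c0) -(mulr_powRB1 (ltW c0) al0); field; rewrite gt_eqF.
by split; [exact: ball_volume_derive|exact: ball_integral_derive].
Qed.

Lemma ball_mean_derive (c : R) : 0 < c ->
  is_derive (c : R) 1 (fun s : R => s * (F s / V s) * al^-1) (H c - (1 - al^-1)
    * (F c / V c)) /\
  {for c, continuous (fun s : R => F s / V s)}.
Proof.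
move=> c0; have [dV dF] := ball_volume_integral_derive c0.
have Vc : V c != 0 by rewrite gt_eqF// ball_volume_gt0.
have cn : c != 0 by rewrite gt_eqF.
have aln : al != 0 by rewrite gt_eqF.
have dVi : is_derive (c : R) 1 (fun s : R => (V s)^-1) (- (V c)^-2 *: (al * V c
  / c)) by exact: is_deriveV.
have dFV := is_deriveM dF dVi.
split; last exact: derivable_continuous_at dFV.
have dm := is_deriveM (is_deriveM (is_derive_id (c : R) 1) dFV)
  (is_derive_cst (al^-1) (c : R) 1).
apply: (is_derive_eq dm).
rewrite /GRing.scale/= !fctE /=.
by field; rewrite Vc cn aln.
Qed.

(* Integration by parts: if B = F / V is the ball mean and P s = s B s / al,
   then H = P' + (1 - 1 / al) B. *)
Lemma annulus_integral_bound (gam C R0 : R) : 0 < R0 -> 0 <= C -> 0 <= gam ->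
  (forall s, R0 < s -> `|F s / V s| <= C * s `^ (- gam)) ->
  exists2 C', 0 <= C' & forall r T, 2 * R0 < r -> 0 < T -> T <= r ->
   `|\int[lebesgue_measure]_(t in `[0, T]) H (r / 2 + t)| <= C' * (r * r `^ (-
     gam)).
Proof.
move=> R00 C0 gam0 hB.
pose k := 1 - al^-1.
(* Every radius s in play is at least r / 2, so s^-gam is at most (1/2)^-gam r^-gam, and K r^-gam
   bounds the ball mean. *)
pose K := C * 2^-1 `^ (- gam); have K0 : 0 <= K by rewrite mulr_ge0// powR_ge0.
(* The boundary values of P contribute (r + T) M / al <= 2 r M / al, and the remaining integral |k|
   M T <= |k| M r, where M = K r^-gam. *)
exists ((2 / al + `|k|) * K) => [|r T r0 T0 Tr].
  by rewrite mulr_ge0// addr_ge0// divr_ge0// ltW.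
have rp : 0 < r by rewrite (lt_trans _ r0)// mulr_gt0.
pose a := r / 2; have a0 : 0 < a by rewrite divr_gt0.
have aR : R0 < a by rewrite /a ltr_pdivlMr// mulrC.
pose ba s := F s / V s.
pose P s := s * ba s * al^-1.
pose M := K * r `^ (- gam); have M0 : 0 <= M by rewrite mulr_ge0// powR_ge0.
have baM s : a <= s -> `|ba s| <= M.
  move=> as0; apply: (le_trans (hB s (lt_le_trans aR as0))).
  rewrite /M /K -mulrA; apply: ler_wpM2l => //.
  rewrite -powRM ?invr_ge0 ?(ltW rp)// mulrC -/a.
  exact: powR_opp_le.
pose f t := H (a + t) - k * ba (a + t).
have dP s : 0 < s -> is_derive (s : R) 1 P (H s - k * ba s) by move=> s0;
  have [] := ball_mean_derive s0.
have dG t : 0 <= t -> is_derive (t : R) 1 (fun t : R => P (a + t)) (f t).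
  move=> t0; have ds : is_derive (t : R) 1 (fun t : R => a + t) 1.
    have := is_deriveD (is_derive_cst a (t : R) 1) (is_derive_id (t : R) 1).
    by move/is_derive_eq; apply; rewrite add0r.
  have := is_derive1_comp (dP (a + t) _) ds; rewrite mulr1; apply.
  by rewrite ltr_wpDr.
have cba t : 0 <= t -> {for t, continuous (fun t : R => ba (a + t))}.
  move=> t0; apply: (@continuous_comp _ _ _ (fun t : R => a + t) ba).
    by apply: cvgD; [exact: cvg_cst|exact: cvg_id].
  by have [] := @ball_mean_derive (a + t) _; rewrite ?ltr_wpDr.
have cH : continuous (fun t : R => H (a + t)).
  apply: (@continuous_compose _ _ _ (fun t : R => a + t) H);
    last exact: sphere_mean_continuous.
  by move=> t; apply: cvgD; [exact: cvg_cst|exact: cvg_id].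
have cwba : {within `[0, T], continuous (fun t : R => ba (a + t))}.
  apply: continuous_in_subspaceT => t /set_mem /=;
    rewrite in_itv/= => /andP[t0 _].
  exact: cba.
have cwH : {within `[0, T], continuous (fun t : R => H (a +
  t))} by exact: continuous_subspaceT.
have ibak : lebesgue_measure.-integrable `[0, T] (EFin \o (fun t : R => ba (a +
  t))).
  by apply: continuous_compact_integrable => //; exact: segment_compact.
have cf : {within `[0, T], continuous f}.
  apply: continuous_in_subspaceT => t /set_mem /=;
    rewrite in_itv/= => /andP[t0 _].
  apply: (@continuousB _ _ _ (fun t : R => H (a + t)) (fun t : R => k * ba (a +
    t))); first exact: cH.
  by apply: (@continuousM _ _ (fun=> k) (fun t : R => ba (a + t)));
    [exact: cst_continuous|exact: cba].
have intf : lebesgue_measure.-integrable `[0, T] (EFin \o f).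
  by apply: continuous_compact_integrable => //; exact: segment_compact.
have mu0T : lebesgue_measure (`[0, T] : set R) =
  T%:E by rewrite lebesgue_measure_itv/= lte_fin T0 sube0.
have If : \int[lebesgue_measure]_(t in `[0, T]) f t = P (a + T) - P a.
  rewrite /Rintegral (@continuous_FTC2 _ f (fun t : R => P (a + t)) 0 T)//.
  - by rewrite addr0.
  - split.
    + by move=> t; rewrite in_itv/= => /andP[/ltW t0 _]; have [] := dG t t0.
    + by apply: cvg_at_right_filter; exact: derivable_continuous_at (dG _ _).
    + by apply: cvg_at_left_filter; apply: derivable_continuous_at (dG _ _);
      exact: ltW.
  - move=> t; rewrite in_itv/= => /andP[/ltW t0 _].
    by rewrite derive1E; have [_ ->] := dG t t0.
have Iba : `|\int[lebesgue_measure]_(t in `[0, T]) ba (a + t)| <= M * T.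
  apply: (le_trans (le_normr_Rintegral _ _)) => //.
  apply: (@le_trans _ _ (\int[lebesgue_measure]_(t in `[0, T]) M)).
    apply: le_Rintegral => //.
    - exact: (integrable_norm ibak).
    - apply: continuous_compact_integrable; [exact: segment_compact|].
      by apply: continuous_subspaceT => ?; exact: cst_continuous.
    by move=> t; rewrite /= in_itv/= => /andP[t0 _]; apply: baM; rewrite lerDl.
  by rewrite Rintegral_cst//= mu0T.
have -> : \int[lebesgue_measure]_(t in `[0, T]) H (r / 2 + t) = P (a + T) - P a
  + k * \int[lebesgue_measure]_(t in `[0, T]) ba (a + t).
  rewrite -If -RintegralZl// -RintegralD//.
    by apply: eq_Rintegral => t _; rewrite /f -/a; ring.
  apply: continuous_compact_integrable; first exact: segment_compact.
  apply: continuous_in_subspaceT => t /set_mem /=;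
    rewrite in_itv/= => /andP[t0 _].
  by apply: (@continuousM _ _ (fun=> k) (fun t : R => ba (a + t)));
    [exact: cst_continuous|exact: cba].
have PM s : a <= s -> `|P s| <= s * M / al.
  move=> as0; rewrite /P normrM [`|al^-1|]gtr0_norm ?invr_gt0//
    ler_pM2r ?invr_gt0// normrM.
  by rewrite [`|s|]gtr0_norm ?(lt_le_trans a0)// ler_pM2l ?(lt_le_trans a0)//
    baM.
apply: (le_trans (ler_normD _ _)); rewrite normrM.
apply: (@le_trans _ _ ((a + T) * M / al + a * M / al + `|k| * (M * T))).
  apply: lerD; last exact: ler_wpM2l.
  by apply: (le_trans (ler_normB _ _)); rewrite lerD// PM// lerDl ltW.
have -> : (2 / al + `|k|) * K * (r * r `^ (- gam)) = 2 * r * M / al + `|k| * (M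
  * r) by rewrite /M; ring.
apply: lerD; last by rewrite ler_wpM2l// ler_wpM2l.
rewrite -mulrDl -mulrDl ler_pM2r ?invr_gt0// ler_wpM2r//.
by rewrite /a; lra.
Qed.

End Polar.

(** * Subtracting a constant from a test function *)

Section SobolevShift.
Variables (R : realType) (n : nat) (G : linearLieGroup R n)
  (Gamma : set 'M[R]_n) (L : {vspace 'M[R]_n}).
Local Notation X := (homog G Gamma).
Variable m : probability (borel X) R.
Local Open Scope complex_scope.
Implicit Types (f : X -> R[i]) (c : R[i]).

Lemma Re_sub (z w : R[i]) : complex.Re (z - w) = complex.Re z - complex.Re w.
Proof. by case: z => a b; case: w. Qed.

Lemma Im_sub (z w : R[i]) : complex.Im (z - w) = complex.Im z - complex.Im w.
Proof. by case: z => a b; case: w. Qed.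

(** The difference quotients are the same function, so their limits agree even where g is not
    differentiable. *)
Lemma derive1_subr (g : R -> R) (k a : R) : derive1 (fun t => g t - k) a =
  derive1 g a.
Proof.
have E : (fun t => t^-1 *: ((g (t + a) - k) - (g a - k))) = (fun t => t^-1 *: (g
  (t + a) - g a)).
  by apply/funext => t; congr (_ *: _); ring.
exact: (congr1 (fun F => lim (F @ 0^')) E).
Qed.

Lemma flow_re_subr A f c y : flow_re A (fun y => f y - c) y = (fun t => flow_re
  A f y t - complex.Re c).
Proof. by apply/funext => t; exact: Re_sub. Qed.

Lemma flow_im_subr A f c y : flow_im A (fun y => f y - c) y = (fun t => flow_im
  A f y t - complex.Im c).
Proof. by apply/funext => t; exact: Im_sub. Qed.

Lemma lie_derive_subr A f c : lie_derive A (fun y => f y - c) = lie_derive A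
  f :> (X -> R[i]).
Proof.
by apply/funext => y; rewrite /lie_derive flow_re_subr flow_im_subr
  !derive1_subr.
Qed.

Lemma class_C_subr k f c : class_C L k f -> class_C L k (fun y => f y - c).
Proof.
have cre (g : X -> R[i]) : continuous (fun y : X => complex.Re (g y)) ->
  continuous (fun y : X => complex.Re (g y - c)).
  move=> cg; under eq_fun do rewrite Re_sub.
  by move=> y; apply: continuousB; [exact: cg|exact: cst_continuous].
have cim (g : X -> R[i]) : continuous (fun y : X => complex.Im (g y)) ->
  continuous (fun y : X => complex.Im (g y - c)).
  move=> cg; under eq_fun do rewrite Im_sub.
  by move=> y; apply: continuousB; [exact: cg|exact: cst_continuous].
(* A case split suffices: from order 1 on, the derivatives of f - c are literally those of f. *)
case: k => [|k] [/cre c1 /cim c2 h]; split => // A AL.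
have [hd hk] := h A AL; rewrite lie_derive_subr; split => // y.
have [d1 d2] := hd y; rewrite flow_re_subr flow_im_subr.
by split; [apply: (derivableB d1)|apply: (derivableB d2)]; exact: derivable_cst.
Qed.

(* Only the term of order 0 of the Sobolev norm sees the constant c. *)
Lemma lie_monomial_subr (s : seq 'I_(\dim L)) f c : s != [::] ->
  lie_monomial s (fun y => f y - c) = lie_monomial s f.
Proof.
(* The last index of the word is the derivative applied first, and it already removes c. *)
elim/last_ind: s => // s i _ _; rewrite /lie_monomial !foldr_rcons;
  congr (foldr _ _ s).
exact: lie_derive_subr.
Qed.

Lemma cabs_Re (z : R[i]) : `|complex.Re z| <= cabs z.
Proof.
case: z => a b; rewrite /cabs /= -sqrtr_sqr ler_wsqrtr// lerDl sqr_ge0//.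
Qed.

Lemma cabs_Im (z : R[i]) : `|complex.Im z| <= cabs z.
Proof.
case: z => a b; rewrite /cabs /= -sqrtr_sqr ler_wsqrtr// lerDr sqr_ge0//.
Qed.

Lemma cabs_le (z : R[i]) : cabs z <= `|complex.Re z| + `|complex.Im z|.
Proof.
case: z => a b; rewrite /cabs /= -[leRHS]ger0_norm ?addr_ge0// -sqrtr_sqr
  ler_wsqrtr//.
by rewrite sqrrD !real_normK ?num_real// addrAC lerDl mulrn_wge0// mulr_ge0.
Qed.

Lemma cabsB (z w : R[i]) : cabs (z - w) <= cabs z + cabs w.
Proof.
by apply: (le_trans (le_normcD (z : Rcomplex R) (- w))); rewrite normcN.
Qed.

Lemma cabs_measurable f : continuous (fun y => complex.Re (f y)) ->
  continuous (fun y => complex.Im (f y)) ->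
  measurable_fun setT (fun y : borel X => cabs (f y)).
Proof.
move=> cre cim; apply: continuous_borel_measurableR.
rewrite (_ : (fun y => _) = (fun y => Num.sqrt (complex.Re (f y) ^+ 2 +
  complex.Im (f y) ^+ 2))).
  apply: (@continuous_compose _ _ _ _ Num.sqrt); last by move=> x;
    exact: sqrt_continuous.
  move=> y; apply: (@continuousD _ _ _ (fun y => complex.Re (f y) ^+ 2)
    (fun y => complex.Im (f y) ^+ 2)).
    by apply: (@continuous_compose _ _ _ _ (fun x : R => x ^+ 2) cre);
      exact: exprn_continuous.
  by apply: (@continuous_compose _ _ _ _ (fun x : R => x ^+ 2) cim);
    exact: exprn_continuous.
by apply/funext => y; rewrite /cabs; case: (f y).
Qed.

End SobolevShift.

(** * Continuity along the orbit *)

Section OrbitMap.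
Variables (R : realType) (n d : nat) (G : linearLieGroup R n)
  (Gamma : set 'M[R]_n).
Local Notation X := (homog G Gamma).

Lemma orbit_map_continuous (u : 'rV[R]_d -> 'M[R]_n) (x : X) : is_Rd_subgroup G
  u ->
  continuous (fun v => act (u v) x).
Proof.
move=> [Gu _ _ cu]; apply/continuousP => A [W oW hW].
(* Lifting x to g in G, an open set of X pulls back to the preimage of an open set of matrices under
   v |-> u_v g. *)
have [g Gg gx] := set_mem (cosetP x).
rewrite (_ : _ @^-1` A = (fun v => u v *m g) @^-1` W).
  by apply: open_comp => // v _; exact: continuous_mulmxr.
have cE v : coset (act (u v) x) = lcoset Gamma (u v *m g).
  rewrite coset_act// -gx; apply/seteqP; split=> z.
    by move=> [_ [c Gc <-] <-]; exists c => //; rewrite mulmxA.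
  by move=> [c Gc <-]; exists (g *m c); [exists c|rewrite mulmxA].
apply/seteqP; split=> v /=; have h := hW (act (u v) x) (u v *m g)
  (lg_mul (Gu v) Gg) (cE v).
  by move/h.
by move/h.
Qed.

End OrbitMap.

Lemma Lnorm_le (d : measure_display) (T : measurableType d) (R : realType)
  (mu : {measure set T -> \bar R}) (p : \bar R) (f g : T -> R) :
  measurable_fun setT f -> measurable_fun setT g -> (1 <= p)%E ->
    (forall x, `|f x| <= `|g x|) ->
  ('N[mu]_p[EFin \o f] <= 'N[mu]_p[EFin \o g])%E.
Proof.
move=> mf mg; case: p => [p||] // p1 fg; rewrite unlock /Lnorm.
  have p0 : 0 <= p by rewrite (le_trans ler01).
  have int_ge0 (h : T -> R) : (\int[mu]_x (`|(EFin \o h) x| `^ p) \in `[0,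
    +oo])%E.
    by rewrite in_itv/= leey andbT; apply: integral_ge0 => x _;
      rewrite lee_fin powR_ge0.
  apply: gt0_ler_poweR; [by rewrite invr_ge0|exact: int_ge0|exact: int_ge0|].
  have mpow (h : T -> R) : measurable_fun setT h ->
    measurable_fun setT (fun x => (`|(h x)%:E| `^ p)%E).
    move=> mh; apply/measurable_EFinP; apply: (@measurableT_comp _ _ _ _ _ _
      (@powR R ^~ p)) => //.
    exact: measurableT_comp.
  apply: ge0_le_integral => //; try exact: mpow; try by move=> x _;
    exact: poweR_ge0.
  by move=> x _; rewrite /= lee_fin ge0_ler_powR ?nnegrE.
case: ifP => // _; apply: le_ess_sup; apply: nearW => x /=.
by rewrite lee_fin.
Qed.

Lemma Lnorm_cst_lty (d : measure_display) (T : measurableType d) (R : realType)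
  (mu : probability T R) (p : \bar R) (c : R) :
  (1 <= p)%E -> ('N[mu]_p[EFin \o (cst c)] < +oo)%E.
Proof.
case: p => [p||]// p1.
  by have := Lfun_cst mu c p; rewrite inE => /andP[_]; rewrite inE.
rewrite unlock /Lnorm; case: ifPn => // mu0.
rewrite (_ : abse \o (EFin \o cst c) = cst `|c|%:E); last by apply/funext.
by rewrite ess_sup_cst ?ltry.
Qed.

Lemma cabs_ge0 (R : realType) (z : R[i]) : 0 <= cabs z.
Proof. by case: z => a b; exact: sqrtr_ge0. Qed.

Section SobolevMean.
Variables (R : realType) (n : nat) (G : linearLieGroup R n)
  (Gamma : set 'M[R]_n) (L : {vspace 'M[R]_n}).
Local Notation X := (homog G Gamma).
Variables (m : probability (borel X) R) (p : \bar R) (K : nat).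
Hypothesis p1 : (1 <= p)%E.
Local Open Scope complex_scope.
Variable f : X -> R[i].
Hypotheses (smf : smooth L f) (Nf : (sobolev_norm L m p K f < +oo)%E).

Let cre : continuous (fun y => complex.Re (f y)). Proof. by have [] :=
  smf 0. Qed.

Let cim : continuous (fun y => complex.Im (f y)). Proof. by have [] :=
  smf 0. Qed.

Let mcabs : measurable_fun setT (fun y : borel X => cabs (f y)).
Proof. exact: cabs_measurable. Qed.

Lemma sobolev_term (k : nat) (s : k.-tuple 'I_(\dim L)) : (k < K.+1)%N ->
  ('N[m]_p[(fun y : borel X => (cabs (lie_monomial s f y))%:E)] < +oo)%E.
Proof.
move=> kK; apply: le_lt_trans Nf; rewrite /sobolev_norm.
rewrite (bigD1 (Ordinal kK))//= (bigD1 s)//= -addeA leeDl// adde_ge0//.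
  by apply: sume_ge0 => t _; exact: Lnorm_ge0.
by apply: sume_ge0 => i _; apply: sume_ge0 => t _; exact: Lnorm_ge0.
Qed.

Lemma sobolev_Lnorm : ('N[m]_p[EFin \o (fun y : borel X => cabs (f y))] <
  +oo)%E.
Proof. exact: (@sobolev_term 0 [tuple]). Qed.

(** Terms of positive order are those of f. The term of order 0 is bounded by Minkowski, constants
    having finite norm for a probability measure. *)
Lemma sobolev_class_subr (c : R[i]) : sobolev_class L m p K (fun y => f y - c).
Proof.
split; first by apply: class_C_subr; exact: smf.
rewrite /sobolev_norm; apply: lte_sum_pinfty => k _;
  apply: lte_sum_pinfty => s _.
case: k s => -[|k] /= kK s; last first.
  rewrite lie_monomial_subr; last by rewrite -size_eq0 size_tuple.
  exact: sobolev_term.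
rewrite (tuple0 s) /=.
have mc : measurable_fun setT (fun y : borel X => cabs (f y - c)).
  by apply: cabs_measurable; have [] := @class_C_subr _ _ _ _ L 0 f c (smf 0).
apply: (@le_lt_trans _ _ ('N[m]_p[EFin \o ((fun y : borel X => cabs (f y)) \+
  cst (cabs c))%R])%E).
  apply: Lnorm_le => //; first exact: measurable_funD.
  by move=> y; rewrite /= !ger0_norm ?addr_ge0 ?cabs_ge0 ?cabsB.
apply: (le_lt_trans (eminkowski _ _ _ p1)) => //.
by rewrite lte_add_pinfty// ?sobolev_Lnorm// Lnorm_cst_lty.
Qed.

Lemma cabs_integrable : m.-integrable setT (EFin \o (fun y : borel X => cabs (f
  y))).
Proof.
apply/Lfun1_integrable.
(* On a finite measure space L^p is contained in L^1 for p >= 1. *)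
apply: (@Lfun_subset _ _ _ m 1%E p) => //; first exact: fin_num_measure.
by rewrite inE; apply/andP; split; rewrite inE//; exact: sobolev_Lnorm.
Qed.

Lemma cintegral_subr : cintegral m setT (fun y : borel X => f y - cintegral m
  setT f) = 0.
Proof.
have ire : m.-integrable setT (EFin \o (fun y : borel X => complex.Re (f y))).
  apply: (le_integrable _ _ _ cabs_integrable) => //.
    by apply/measurable_EFinP; exact: continuous_borel_measurableR.
  by move=> y _; rewrite /= lee_fin (le_trans (cabs_Re _))// ler_norm.
have iim : m.-integrable setT (EFin \o (fun y : borel X => complex.Im (f y))).
  apply: (le_integrable _ _ _ cabs_integrable) => //.
    by apply/measurable_EFinP; exact: continuous_borel_measurableR.
  by move=> y _; rewrite /= lee_fin (le_trans (cabs_Im _))// ler_norm.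
have icst (k : R) : m.-integrable setT (EFin \o (fun _ : borel X => k)).
  exact: finite_measure_integrable_cst.
have h (g : borel X -> R) : m.-integrable setT (EFin \o g) ->
  \int[m]_(y in setT) (g y - \int[m]_(y in setT) g y) = 0.
  move=> ig; rewrite RintegralB// Rintegral_cst// (_ : fine _ =
    1) ?mulr1 ?subrr//.
  exact: (congr1 fine (probability_setT m)).
rewrite /cintegral; apply/eqP; rewrite eq_complex /=; apply/andP; split;
  apply/eqP.
  by rewrite -[RHS](h _ ire); apply: eq_Rintegral => y _; rewrite Re_sub.
by rewrite -[RHS](h _ iim); apply: eq_Rintegral => y _; rewrite Im_sub.
Qed.

End SobolevMean.

(* For small r the annulus stays in a fixed ball because omega > 0, and the
   right-hand side is bounded below. *)
Lemma annulus_mean_decay (R : realType) (d : nat) (lam : {measure set (borel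
  'rV[R]_d) -> \bar R}) (sigma : probability (borel 'rV[R]_d) R)
  (h : 'rV[R]_d -> R) (gam C R0 omega : R) :
  is_haar_Rd lam -> is_sphere_measure sigma -> continuous h -> 0 < R0 ->
    0 <= C -> 0 < gam -> 0 < omega <= 1 -> 0 < gam + omega - 1 ->
  (forall s, R0 < s -> `|ball_integral lam h s / ball_volume lam s| <= C * s `^
    (- gam)) ->
  exists2 C', 0 <= C' & forall r, 0 < r ->
    `|(r `^ omega)^-1 * \int[lebesgue_measure]_(t in `[0, r `^ omega])
      sphere_mean sigma h (r / 2 + t)| <= C' * r `^ (- (gam + omega - 1)).
Proof.
move=> hl hs ch R00 C0 gam0 /andP[om0 om1] del0 hB.
have [al al0 Vpow] := ball_volume_power hl (sphere_nonempty hs).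
have [C1 C10 hC1] := annulus_integral_bound hl hs ch Vpow al0 R00 C0 (ltW gam0)
  hB.
(* For r > r0 the annulus lies beyond R0, and r >= 1 gives r^omega <= r, as the integral bound
   requires. *)
pose r0 := 1 + 2 * R0; have r00 : 0 < r0 by rewrite addr_gt0// mulr_gt0.
have cH := sphere_mean_continuous hs ch.
have [N N0 hN] := compact_bounded_fun (@segment_compact R 0 (r0 / 2 +
  r0 `^ omega)) cH.
(* C1 serves large r. For r <= r0 the average is at most N, and r0^delta r^-delta >= 1 with delta =
   gam + omega - 1. *)
exists (C1 + N * r0 `^ (gam + omega - 1)) => [|r rp];
  first by rewrite addr_ge0// mulr_ge0// powR_ge0.
have T0 : 0 < r `^ omega by rewrite powR_gt0.
rewrite normrM [`|(r `^ omega)^-1|]gtr0_norm ?invr_gt0//.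
have [rr0|rr0] := ltP r0 r.
  have r1 : 1 <= r by rewrite (le_trans _ (ltW rr0))// lerDl mulr_ge0// ltW.
  have r2 : 2 * R0 < r by rewrite (le_lt_trans _ rr0)// lerDr.
  have := hC1 r _ r2 T0 (ler1_powR r1 om1) => hI.
  apply: (@le_trans _ _ ((r `^ omega)^-1 * (C1 * (r * r `^ (- gam))))).
    by apply: ler_wpM2l hI; rewrite invr_ge0 ltW.
  have -> : (r `^ omega)^-1 * (C1 * (r * r `^ (- gam))) = C1 * r `^ (- (gam +
    omega - 1)).
    have rn : r != 0 by rewrite gt_eqF.
    have -> : - (gam + omega - 1) = (1 + - gam) + - omega by ring.
    rewrite powRD ?rn ?implybT// powRD ?rn ?implybT// powRr1 ?ltW// powRN [r `^
      (- omega)]powRN; ring.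
  by apply: ler_wpM2r; [exact: powR_ge0|rewrite lerDl mulr_ge0// powR_ge0].
have Hb t : `[0, r `^ omega]%classic t -> `|sphere_mean sigma h (r / 2 + t)| <=
  N.
  rewrite /= in_itv/= => /andP[t0 tT]; apply: hN; rewrite /= in_itv/=;
    apply/andP; split.
    by rewrite addr_ge0// divr_ge0// ltW.
  apply: lerD; first by rewrite ler_pM2r.
  by apply: (le_trans tT); apply: ge0_ler_powR; rewrite ?nnegrE ?(ltW om0) ?(ltW
    rp) ?(ltW r00).
have cHs : continuous (fun t : R => sphere_mean sigma h (r / 2 + t)).
  apply: (@continuous_compose _ _ _ (fun t : R => r / 2 + t) (sphere_mean sigma
    h)) => //.
  by move=> t; apply: cvgD; [exact: cvg_cst|exact: cvg_id].
have iH : lebesgue_measure.-integrable `[0, r `^ omega] (EFin \o (fun t : R =>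
  sphere_mean sigma h (r / 2 + t))).
  by apply: continuous_compact_integrable; [exact: segment_compact|exact:
    continuous_subspaceT].
have mu0T : lebesgue_measure (`[0, r `^ omega] : set R) = (r `^ omega)%:E
  by rewrite lebesgue_measure_itv/= lte_fin T0 sube0.
have IN : `|\int[lebesgue_measure]_(t in `[0, r `^ omega]) sphere_mean sigma h
  (r / 2 + t)| <= N * r `^ omega.
  apply: (le_trans (le_normr_Rintegral _ _)) => //.
  apply: (@le_trans _ _ (\int[lebesgue_measure]_(t in `[0, r `^ omega]) N)).
    apply: le_Rintegral => //; first exact: (integrable_norm iH).
    apply: continuous_compact_integrable; [exact: segment_compact|].
    by apply: continuous_subspaceT => ?; exact: cst_continuous.
  by rewrite Rintegral_cst//= mu0T.
apply: (@le_trans _ _ N).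
  by rewrite mulrC ler_pdivrMr.
have hp : 1 <= r0 `^ (gam + omega - 1) * r `^ (- (gam + omega - 1)).
  apply: (@le_trans _ _ (r0 `^ (gam + omega - 1) * r0 `^ (- (gam + omega -
    1)))).
    by rewrite powRN divff// gt_eqF// powR_gt0.
  by apply: ler_wpM2l; [exact: powR_ge0|apply: powR_opp_le => //; exact: ltW].
rewrite mulrDl -[leLHS]add0r lerD//; first by rewrite mulr_ge0// powR_ge0.
by rewrite -mulrA -[leLHS]mulr1 ler_wpM2l.
Qed.

(** * Reduction of complex averages along the orbit to real means *)

Section Annulus.
Variables (R : realType) (n d : nat) (G : linearLieGroup R n)
  (Gamma : set 'M[R]_n) (u : 'rV[R]_d -> 'M[R]_n).
Local Notation X := (homog G Gamma).
Local Open Scope complex_scope.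
Hypothesis hu : is_Rd_subgroup G u.
Variables (lam : {measure set (borel 'rV[R]_d) ->
  \bar R}) (sigma : probability (borel 'rV[R]_d) R).
Hypotheses (hl : is_haar_Rd lam) (hs : is_sphere_measure sigma).
Variables (f : X -> R[i]) (c : R[i]) (x : X).
Hypotheses (cre : continuous (fun y => complex.Re (f y)))
  (cim : continuous (fun y => complex.Im (f y))).

Let hre v := complex.Re (f (act (u v) x)) - complex.Re c.

Let him v := complex.Im (f (act (u v) x)) - complex.Im c.

Lemma orbit_re_continuous : continuous (fun v => complex.Re (f (act (u v) x))).
Proof. exact: continuous_compose (orbit_map_continuous hu) cre. Qed.

Lemma orbit_im_continuous : continuous (fun v => complex.Im (f (act (u v) x))).
Proof. exact: continuous_compose (orbit_map_continuous hu) cim. Qed.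

Lemma centered_re_continuous : continuous hre.
Proof. by move=> v; apply: continuousB; [exact: orbit_re_continuous|exact:
  cst_continuous]. Qed.

Lemma centered_im_continuous : continuous him.
Proof. by move=> v; apply: continuousB; [exact: orbit_im_continuous|exact:
  cst_continuous]. Qed.

Lemma complexM_real (k a b : R) : k%:C * (a +i* b) = (k * a) +i* (k * b).
Proof. by apply/eqP; rewrite eq_complex /= !mul0r subr0 addr0 !eqxx. Qed.

Lemma complexB_parts (a b : R) (z : R[i]) : (a +i* b) - z = (a - complex.Re z)
  +i* (b - complex.Im z).
Proof. by case: z. Qed.

Lemma ball_average_parts r : ball_average u lam r (fun y => f y - c) x =
  (ball_integral lam hre r / ball_volume lam r) +i* (ball_integral lam him r /
    ball_volume lam r).
Proof.
rewrite /ball_average complexM_real [_ * Rintegral _ _ _]mulrC [X in _ +i*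
  X]mulrC.
congr ((_ / _) +i* (_ / _)); apply: eq_Rintegral => v _;
  [exact: Re_sub|exact: Im_sub].
Qed.

(** Both [sigma] on the sphere and the normalized length on [0, T] have mass 1, so averaging fixes
    constants. *)
Lemma annulus_mean_subr (g : 'rV[R]_d -> R) (k T a : R) : continuous g ->
  0 < T ->
  T^-1 * (\int[lebesgue_measure]_(t in `[0, T]) sphere_mean sigma g (a + t)) - k
    =
  T^-1 * \int[lebesgue_measure]_(t in `[0, T]) sphere_mean sigma (fun v => g v -
    k) (a + t).
Proof.
move=> cg T0.
have mS : measurable (@esphere R d : set (borel 'rV[R]_d))
  by exact: esphere_measurable.
have E s : sphere_mean sigma (fun v => g v - k) s = sphere_mean sigma g s - k.
  rewrite /sphere_mean RintegralB//.
  - by rewrite Rintegral_cst// (_ : fine _ = 1) ?mulr1//;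
    exact: (congr1 fine hs.1).
  - by apply: sphere_integrable => //; exact: dilate_continuous.
  - by apply: sphere_integrable => //; exact: cst_continuous.
have mu0T : lebesgue_measure (`[0, T] : set R) =
  T%:E by rewrite lebesgue_measure_itv/= lte_fin T0 sube0.
under [in RHS]eq_Rintegral do rewrite E.
rewrite RintegralB//.
- by rewrite Rintegral_cst//= mu0T /= mulrBr [k * T]mulrC mulKf// gt_eqF.
- apply: continuous_compact_integrable; [exact: segment_compact|apply:
  continuous_subspaceT].
  apply: (@continuous_compose _ _ _ (fun t : R => a + t) (sphere_mean sigma g));
    last exact: sphere_mean_continuous.
  by move=> t; apply: cvgD; [exact: cvg_cst|exact: cvg_id].
- apply: continuous_compact_integrable; [exact: segment_compact|].
  by apply: continuous_subspaceT => ?; exact: cst_continuous.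
Qed.

Lemma annulus_average_parts omega r : 0 < r -> annulus_average u sigma omega r f
  x - c =
  ((r `^ omega)^-1 * \int[lebesgue_measure]_(t in `[0, r `^ omega]) sphere_mean
    sigma hre (r / 2 + t)) +i*
  ((r `^ omega)^-1 * \int[lebesgue_measure]_(t in `[0, r `^ omega]) sphere_mean
    sigma him (r / 2 + t)).
Proof.
move=> r0; have T0 : 0 < r `^ omega by rewrite powR_gt0.
rewrite /annulus_average complexM_real complexB_parts; congr (_ +i* _).
  exact: (annulus_mean_subr (complex.Re c) (r / 2) orbit_re_continuous T0).
exact: (annulus_mean_subr (complex.Im c) (r / 2) orbit_im_continuous T0).
Qed.

Lemma annulus_average_decay (gam C R0 omega : R) :
  0 < R0 -> 0 <= C -> 0 < gam -> 0 < omega <= 1 -> 0 < gam + omega - 1 ->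
  (forall s, R0 < s -> cabs (ball_average u lam s (fun y => f y - c) x) <=
    C * s `^ (- gam)) ->
  exists C', forall r, 0 < r -> cabs (annulus_average u sigma omega r f x - c)
    <= C' * r `^ (- (gam + omega - 1)).
Proof.
move=> R00 C0 gam0 om0 del0 hB.
(* The modulus of the ball average dominates its real and imaginary parts, so the real estimate
   applies to each of them. *)
have [C1 _ h1] : exists2 C', 0 <= C' & forall r, 0 < r ->
    `|(r `^ omega)^-1 * \int[lebesgue_measure]_(t in `[0, r `^ omega])
      sphere_mean sigma hre (r / 2 + t)| <= C' * r `^ (- (gam + omega - 1)).
  apply: (annulus_mean_decay hl hs centered_re_continuous R00 C0 gam0 om0
    del0) => s sR.
  by apply: le_trans (hB s sR); rewrite ball_average_parts;
    exact: le_trans (cabs_Re _).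
have [C2 _ h2] : exists2 C', 0 <= C' & forall r, 0 < r ->
    `|(r `^ omega)^-1 * \int[lebesgue_measure]_(t in `[0, r `^ omega])
      sphere_mean sigma him (r / 2 + t)| <= C' * r `^ (- (gam + omega - 1)).
  apply: (annulus_mean_decay hl hs centered_im_continuous R00 C0 gam0 om0
    del0) => s sR.
  by apply: le_trans (hB s sR); rewrite ball_average_parts;
    exact: le_trans (cabs_Im _).
exists (C1 + C2) => r r0; rewrite annulus_average_parts//.
apply: (le_trans (cabs_le _)); rewrite mulrDl.
exact: lerD (h1 r r0) (h2 r r0).
Qed.

End Annulus.

Theorem theorem1p3 (R : realType) (n d K : nat)
  (G : linearLieGroup R n) (L : {vspace 'M[R]_n})
  (hL : is_lie_algebra G L) (hss : semisimple_lie L)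
  (Gamma : set 'M[R]_n) (hGamma : is_lattice G Gamma)
  (m : probability (borel (homog G Gamma)) R) (hm : induced_by_haar m)
  (u : 'rV[R]_d -> 'M[R]_n) (hu : is_Rd_subgroup G u)
  (lam : {measure set (borel 'rV[R]_d) -> \bar R}) (hlam : is_haar_Rd lam)
  (sigma : probability (borel 'rV[R]_d) R) (hsigma : is_sphere_measure sigma)
  (p : \bar R) (hp : (1 <= p)%E) :
  exists delta : R -> R -> R,
  forall (x : homog G Gamma) (gamma : R),
    generic u x -> 0 < gamma ->
    effective_equidistribution u lam m (sobolev_class L m p K) gamma x ->
    exists2 omega_critical : R, omega_critical < 1 &
    forall omega : R, omega_critical < omega -> omega <= 1 ->
      0 < delta gamma omega /\
      forall f : homog G Gamma -> R[i],
        smooth L f -> (sobolev_norm L m p K f < +oo)%E ->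
        exists C : R, forall r : R, 0 < r ->
          cabs (annulus_average u sigma omega r f x - cintegral m setT f)
            <= C * r `^ (- delta gamma omega).
Proof.
exists (fun gam w => gam + w - 1) => x gam _ gam0 [R0 R00 eff].
(* omega > 0 is needed for the bound at small r, when gam > 1. *)
exists (Num.max (1 - gam) 0); first by rewrite gt_max ltr01 andbT ltrBlDr ltrDl.
move=> w; rewrite gt_max => /andP[w1 w0] w2.
have del0 : 0 < gam + w - 1 by rewrite subr_gt0 -ltrBlDl.
split=> // f smf Nf.
(* The test function is f minus its integral. *)
have [C hC] := eff _ (sobolev_class_subr hp smf Nf _)
  (cintegral_subr hp smf Nf).
have [cre cim _] := smf 0.
(* The constant given by the hypothesis carries no sign, hence its absolute value. *)
apply: (@annulus_average_decay _ _ _ _ _ _ hu lam sigma hlam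
  hsigma f _ x cre cim gam `|C| R0 w) => //.
  by rewrite w0 w2.
move=> s sR; apply: (le_trans (hC s sR)).
by apply: ler_wpM2r; [exact: powR_ge0|exact: ler_norm].
Qed.
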